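(* Let $n\ge1$ and $L>0$. Let $\gamma\colon[0,1]\to\mathbb{R}^{2n}$ be a curve such that $|\gamma(s)-\gamma(t)|\le L\sqrt{|s-t|}$ for all $s,t\in[0,1]$. For $i\ge0$ and $j=0,\dots,2^i$, let $\Lambda_{i,j}\in\mathbb{R}^{2n}$ be such that $|\Lambda_{i,j}-\gamma(j2^{-i})|\le L2^{-\frac i2}$. For each $i$, let $h_i=\overline{\Lambda_{i,0},\dots,\Lambda_{i,2^i}}$ be the curve that connects $\Lambda_{i,0},\dots,\Lambda_{i,2^i}$ by straight line segments. For $0\le j\le 2^i-1$ let $$\delta_{i,j}=\operatorname{diam}\big(\{\Lambda_{i,j},\Lambda_{i,j+1},\Lambda_{i+1,2j},\Lambda_{i+1,2j+1},\Lambda_{i+1,2j+2}\}\big).$$ If $$\sigma:=\sum_{i=0}^\infty\sum_{j=0}^{2^i-1}\delta_{i,j}^2<\infty,$$ then $S(\hat\gamma)$ exists, $S(\hat\gamma)=\lim_{i\to\infty}S(\hat h_i)$, and $$|S(\hat\gamma)|\lesssim\sigma\max\left\{1,\log\frac{L^2}{\sigma}\right\}$$ (the right-hand side being read as $0$ if $\sigma=0$). If $h_i(0)=h_i(1)$ for all $i$, or if $h_i(0)=\gamma(0)$ and $h_i(1)=\gamma(1)$ for all $i$, then $|S(\hat\gamma)|\lesssim\sigma$.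
   Context: For a curve $g$, $\hat g$ is the closed curve obtained by joining the endpoints of $g$ with a straight line segment. Symplectic area: write points of $\mathbb{R}^{2n}$ as $(x_1,y_1,\dots,x_n,y_n)$ and let $\omega(u,\bar u)=\sum_{i=1}^n(x_i\bar y_i-\bar x_iy_i)$. For a continuous curve $\gamma\colon[a,b]\to\mathbb{R}^{2n}$ and a partition $P=\{t_1<\dots<t_k\}$ of $[a,b]$ with $t_1=a$, $t_k=b$, let $\hat S(\gamma_P)=\frac12\sum_{i=1}^{k-1}\omega(\gamma(t_i),\gamma(t_{i+1}))$. The symplectic area $S(\gamma)$ exists and equals $A$ if for every $\epsilon>0$ there is $\delta>0$ such that $\operatorname{mesh}(P)=\max_i(t_{i+1}-t_i)<\delta$ implies $|A-\hat S(\gamma_P)|<\epsilon$. (This is independent of monotone reparameterization, and for Lipschitz $\gamma$ it equals $\int_\gamma\frac12\sum_i(x_i\,\mathrm{d}y_i-y_i\,\mathrm{d}x_i)$.) $X\lesssim Y$ means $X\le cY$ with $c$ a universal constant (depending at most on the fixed $n$). *)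

(* Defs.v *)
From HB Require Import structures.
From mathcomp Require Import all_boot all_order all_algebra.
From mathcomp Require Import all_classical all_reals all_analysis.

Set Implicit Arguments.
Unset Strict Implicit.
Unset Printing Implicit Defensive.

Import Order.TTheory GRing.Theory Num.Theory.
Import numFieldNormedType.Exports.

Local Open Scope classical_set_scope.
Local Open Scope ring_scope.

(* A point (x_1, y_1, ..., x_n, y_n) of R^{2n} is a row vector of length n * 2;
   since vec_mx is row-major, row i of [vec_mx u] is the pair (x_i, y_i). *)

Definition omega (R : realType) (n : nat) (u v : 'rV[R]_(n * 2)) : R :=
  \sum_(i < n) (vec_mx u i 0 * vec_mx v i 1 - vec_mx v i 0 * vec_mx u i 1).

(* The norm that the library puts on row vectors is the sup norm. *)
Definition enorm (R : realType) (m : nat) (u : 'rV[R]_m) : R :=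
  Num.sqrt (\sum_(i < m) u 0 i ^+ 2).

Definition diam (R : realType) (m : nat) (s : seq 'rV[R]_m) : R :=
  \big[Num.max/0]_(p <- s) \big[Num.max/0]_(q <- s) enorm (p - q).

(* As in the library's [itv_partition a b s], the partition points are a :: s. *)

Definition mesh (R : realType) (a b : R) (s : seq R) : R :=
  let t := nth b (a :: s) in
  \big[Num.max/0]_(0 <= k < size s) (t k.+1 - t k).

Definition partition_area (R : realType) (n : nat) (a b : R)
    (g : R -> 'rV[R]_(n * 2)) (s : seq R) : R :=
  let t := nth b (a :: s) in
  2^-1 * \sum_(0 <= k < size s) omega (g (t k)) (g (t k.+1)).

(* The symplectic area of the restriction of g to [a, b] exists and equals A. *)
Definition has_symplectic_area (R : realType) (n : nat) (a b : R)
    (g : R -> 'rV[R]_(n * 2)) (A : R) : Prop :=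
  forall eps : R, 0 < eps ->
  exists2 delta : R, 0 < delta &
    forall s : seq R, itv_partition a b s -> mesh a b s < delta ->
      `|A - partition_area a b g s| < eps.

Definition segment (R : realType) (m : nat) (p q : 'rV[R]_m) (t : R) : 'rV[R]_m :=
  (1 - t) *: p + t *: q.

(* For a curve g on [0, 1], the closed curve obtained from it, parametrized by
   [0, 2]: the closing segment from g 1 to g 0 is run through during [1, 2]. *)
Definition close_up (R : realType) (m : nat) (g : R -> 'rV[R]_m) (t : R) : 'rV[R]_m :=
  if t <= 1 then g t else segment (g 1) (g 0) (t - 1).

(* The polygonal curve through p 0, ..., p N, parametrized by [0, 1] so that p j
   is reached at time j / N.  At time 1 the value is p N: the point p N.+1 occurs
   there with coefficient 0. *)
Definition polyline (R : realType) (m N : nat) (p : nat -> 'rV[R]_m) (t : R) : 'rV[R]_m :=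
  let k := Num.truncn (N%:R * t) in
  segment (p k) (p k.+1) (N%:R * t - k%:R).

(* Main.v *)
Require Import Defs.
From HB Require Import structures.
From mathcomp Require Import all_boot all_order all_algebra.
From mathcomp Require Import all_classical all_reals all_analysis.
From mathcomp Require Import ring lra zify.

Set Implicit Arguments.
Unset Strict Implicit.
Unset Printing Implicit Defensive.

Import Order.TTheory GRing.Theory Num.Theory.
Import numFieldNormedType.Exports.

Local Open Scope classical_set_scope.
Local Open Scope ring_scope.

(** The area of the curve is the limit of the areas of the closed polygons, and it is
computed by comparing consecutive levels. Replacing the polygon of level [i] by that
of level [i + 1] sweeps one pentagon for every edge, whose area is at most a constant
times the square of the diameter of its cell; these areas sum to a multiple of
[sigma]. The closing chord also moves, from [u v] to [u' v'], and sweeps a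
quadrilateral ([excess_step]). Its area is at most [(D + e) ^ 2 - D ^ 2] up to a
constant, where [e] is the displacement of the two ends and [D] bounds the length of
the chord ([norm_quad]); as [D] is bounded by the sum of the earlier displacements,
the quadrilaterals add up to the square of the sum of all displacements
([excess_variation]). The displacements are bounded by diameters, so the sum of their
squares is at most a multiple of [sigma], and they decay like [2 ^ (- i / 2)];
Cauchy-Schwarz on the first [N] levels and the geometric decay on the others give a
bound of the form [N * sigma + L ^ 2 * 2 ^ (- N)] ([sqr_sum_decay]), and the choice of
[N] near [log (L ^ 2 / sigma)] gives the logarithm ([le_mul_max_ln]). If all polygons are
closed, or all have the end points of the curve, then the quadrilaterals are
degenerate and the bound is a multiple of [sigma].

For the existence of the area, the same estimate is applied to each interval of a fine
subdivision of the unit interval, starting from the level whose step is comparable to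
the length of the subinterval ([interval_excess]). The diameters used for different
subintervals belong to disjoint ranges of edges of fine levels, up to one neighbouring
cell for each edge, so their squares sum to a multiple of a tail of the series, and the geometric errors are [2 ^ (- N)] times the lengths, which sum to
[2 ^ (- N)] ([partition_excess]). Choosing [N] and then the mesh makes the difference
between the area sum of the subdivision and the limit arbitrarily small
([doubled_area_limit]). The closing segment and the edges of the polygons have explicit
areas, and [doubled_area_cat] glues the pieces. *)

(** * The symplectic form in the sup norm *)

Lemma ler_eq (R : realType) (x y : R) : x = y -> x <= y.
Proof. by move=> ->. Qed.

(** All estimates use the sup norm of row vectors, for which this is the norm of
[omega]; as the sup norm is below the Euclidean norm, the hypotheses carry over to it. *)
Definition omega_bound (R : realType) (n : nat) : R := (n * 2)%:R.

Section OmegaTheory.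
Context {R : realType} {n : nat}.
Implicit Types u v x y : 'rV[R]_(n * 2).
Local Notation M := (omega_bound R n).

Lemma omega_bound_ge0 : 0 <= M. Proof. exact: ler0n. Qed.

Let vec_mxD u v i j : vec_mx (u + v) i j = vec_mx u i j + vec_mx v i j :> R.
Proof. by rewrite linearD mxE. Qed.

Let vec_mxZ a u i j : vec_mx (a *: u) i j = a * vec_mx u i j :> R.
Proof. by rewrite linearZ mxE. Qed.

Lemma omegaDl u u' v : omega (u + u') v = omega u v + omega u' v.
Proof.
rewrite /omega -big_split /=; apply: eq_bigr => i _.
rewrite !vec_mxD; ring.
Qed.

Lemma omegaC u v : omega v u = - omega u v.
Proof.
rewrite /omega -sumrN; apply: eq_bigr => i _; ring.
Qed.

Lemma omegaZl a u v : omega (a *: u) v = a * omega u v.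
Proof.
rewrite /omega mulr_sumr; apply: eq_bigr => i _.
rewrite !vec_mxZ; ring.
Qed.

Lemma omegaNl u v : omega (- u) v = - omega u v.
Proof. by rewrite -scaleN1r omegaZl mulN1r. Qed.

Lemma omegaBl u u' v : omega (u - u') v = omega u v - omega u' v.
Proof. by rewrite omegaDl omegaNl. Qed.

Lemma omegaDr u v v' : omega u (v + v') = omega u v + omega u v'.
Proof. by rewrite omegaC omegaDl opprD (omegaC u v) (omegaC u v') !opprK. Qed.

Lemma omegaZr a u v : omega u (a *: v) = a * omega u v.
Proof. by rewrite omegaC omegaZl -mulrN (omegaC u v) opprK. Qed.

Lemma omegaBr u v v' : omega u (v - v') = omega u v - omega u v'.
Proof. by rewrite omegaDr (omegaC (- v') u) omegaNl opprK (omegaC u v'). Qed.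

Lemma omegavv u : omega u u = 0.
Proof. by have := omegaC u u; lra. Qed.

Lemma norm_omega u v : `|omega u v| <= M * (`|u| * `|v|).
Proof.
rewrite (le_trans (ler_norm_sum _ _ _))// /omega_bound.
have H i : `|vec_mx u i 0 * vec_mx v i 1 - vec_mx v i 0 * vec_mx u i 1|
    <= 2 * (`|u| * `|v|).
  have coord (x : 'rV[R]_(n * 2)) k l : `|vec_mx x k l| <= `|x|.
    rewrite mxE [leRHS]/Num.norm /= mx_normrE.
    exact: (le_bigmax _ (fun a => `|x a.1 a.2|) (0, mxvec_index k l)).
  rewrite (le_trans (ler_normB _ _))// !normrM mulr2n mulrDl !mul1r.
  by apply: lerD; [|rewrite [leLHS]mulrC]; exact: ler_pM.
rewrite (le_trans (ler_sum _ (fun i _ => H i)))// sumr_const card_ord.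
by rewrite natrM -mulrA -[leLHS]mulr_natl.
Qed.

Lemma norm_omega_le u v a b : `|u| <= a -> `|v| <= b -> `|omega u v| <= M * (a * b).
Proof.
move=> ua vb; apply: (le_trans (norm_omega _ _)).
by rewrite ler_wpM2l ?omega_bound_ge0// ler_pM.
Qed.

(** The sum of [omega] along the edges of a closed triangle only depends on
two edge vectors: this is what makes all the areas below translation invariant. *)
Lemma omega_triangle u v x :
  omega u v + omega v x + omega x u = omega (v - u) (x - u).
Proof.
rewrite omegaBl !omegaBr omegavv (omegaC u x) (omegaC u v); ring.
Qed.

Lemma norm_omega_triangle u v x a b : `|v - u| <= a -> `|x - u| <= b ->
  `|omega u v + omega v x + omega x u| <= M * (a * b).
Proof. by rewrite omega_triangle; exact: norm_omega_le. Qed.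

Lemma ler_norm_enorm (m : nat) (w : 'rV[R]_m) : `|w| <= enorm w.
Proof.
rewrite /Num.norm /= mx_normrE; apply: bigmax_le; first exact: sqrtr_ge0.
move=> [i j] _ /=; rewrite /enorm -sqrtr_sqr ler_wsqrtr//.
rewrite [i]ord1 (bigD1 j)//= lerDl sumr_ge0// => k _; exact: sqr_ge0.
Qed.

Lemma cvg_omega (x y : nat -> 'rV[R]_(n * 2)) u v :
  x @ \oo --> u -> y @ \oo --> v -> (fun m => omega (x m) (y m)) @ \oo --> omega u v.
Proof.
move=> xu yv.
have coord (z : nat -> 'rV[R]_(n * 2)) (w : 'rV[R]_(n * 2)) i j : z @ \oo --> w ->
    (fun m => vec_mx (z m) i j) @ \oo --> vec_mx w i j.
  move=> zw; rewrite mxE; under eq_fun do rewrite mxE.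
  exact: (cvg_comp _ _ zw (@coord_continuous R 1 (n * 2) 0 (mxvec_index i j) w)).
rewrite /omega; apply: cvg_big => [|i _]; first exact: add_continuous.
by apply: cvgB; apply: cvgM; exact: coord.
Qed.
End OmegaTheory.

(** * Polygonal chains at two consecutive scales *)

Section Excess.
Context {R : realType} {n : nat}.
Local Notation V := 'rV[R]_(n * 2).
Local Notation M := (omega_bound R n).
Implicit Types (p : nat -> V) (L : nat -> nat -> V).

Definition chain p (a b : nat) : R := \sum_(a <= j < b) omega (p j) (p j.+1).

(** Twice the symplectic area of the closed polygon formed by the chain and its
chord; unlike [chain] it is invariant under translations. *)
Definition excess p (a b : nat) : R := chain p a b - omega (p a) (p b).

Definition quad (u v v' u' : V) : R :=
  omega u v + omega v v' + omega v' u' + omega u' u.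

(** The points whose diameter enters the hypothesis of the theorem. *)
Definition cell L (i j : nat) : seq V :=
  [:: L i j; L i j.+1; L i.+1 (2 * j)%N; L i.+1 (2 * j + 1)%N; L i.+1 (2 * j + 2)%N].

(** The diameter in the sup norm. *)
Definition width (s : seq V) : R :=
  \big[Num.max/0]_(x <- s) \big[Num.max/0]_(y <- s) `|x - y|.

Lemma le_bigmax2 (F : V -> V -> R) (s : seq V) u v : u \in s -> v \in s ->
  F u v <= \big[Num.max/0]_(x <- s) \big[Num.max/0]_(y <- s) F x y.
Proof.
move=> us vs; apply: (le_trans (le_bigmax_seq 0 v xpredT (F u) vs isT)).
exact: (le_bigmax_seq 0 u xpredT (fun x => \big[Num.max/0]_(y <- s) F x y) us isT).
Qed.

Lemma le_width (s : seq V) u v : u \in s -> v \in s -> `|u - v| <= width s.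
Proof. exact: (le_bigmax2 (fun x y => `|x - y|)). Qed.

Lemma width_ge0 (s : seq V) : 0 <= width s.
Proof. by rewrite /width; elim/big_rec: _ => // u x _ x0; rewrite le_max x0 orbT. Qed.

Lemma width_le (s : seq V) e : 0 <= e ->
  (forall u v, u \in s -> v \in s -> `|u - v| <= e) -> width s <= e.
Proof.
move=> e0 H; rewrite /width big_seq; apply: bigmax_le => // u us.
by rewrite big_seq; apply: bigmax_le => // v vs; exact: H.
Qed.

Lemma width_le_diam (s s' : seq V) : {subset s <= s'} -> width s <= diam s'.
Proof.
have diam0 : 0 <= diam s'.
  by rewrite /diam; elim/big_rec: _ => // u x _ x0; rewrite le_max x0 orbT.
move=> ss'; apply: width_le => // u v /ss' us /ss' vs.
apply: (le_trans (ler_norm_enorm _)).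
exact: (le_bigmax2 (fun x y => enorm (x - y))).
Qed.

Lemma chain_cat p a b c : (a <= b)%N -> (b <= c)%N ->
  chain p a c = chain p a b + chain p b c.
Proof. by move=> ab bc; rewrite /chain (big_cat_nat ab bc). Qed.

(** Replacing one edge of level [i] by the two edges of level [i.+1] below it sweeps
a pentagon, which three triangles with apex [L i j] fill; its vertices lie in one
cell. *)
Lemma norm_pentagon L i j (d := width (cell L i j)) :
  `|omega (L i.+1 (2 * j)%N) (L i.+1 (2 * j + 1)%N)
    + omega (L i.+1 (2 * j + 1)%N) (L i.+1 (2 * j + 2)%N)
    - omega (L i j) (L i j.+1)
    + omega (L i j) (L i.+1 (2 * j)%N)
    - omega (L i j.+1) (L i.+1 (2 * j + 2)%N)| <= M * (3 * d ^+ 2).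
Proof.
set p := L i j; set q := L i j.+1.
set a := L i.+1 (2 * j)%N; set b := L i.+1 (2 * j + 1)%N.
set c := L i.+1 (2 * j + 2)%N.
have le_d u v : u \in cell L i j -> v \in cell L i j -> `|u - v| <= d.
  exact: le_width.
have -> : omega a b + omega b c - omega p q + omega p a - omega q c =
    (omega p a + omega a b + omega b p) + (omega p b + omega b c + omega c p)
    + (omega p c + omega c q + omega q p).
  rewrite (omegaC p b) (omegaC p c) (omegaC p q) (omegaC q c); ring.
have tri u v : u \in cell L i j -> v \in cell L i j ->
    `|omega p u + omega u v + omega v p| <= M * (d * d).
  move=> uC vC; apply: norm_omega_triangle; apply: le_d => //;
  by rewrite inE eqxx.
have pa : a \in cell L i j by rewrite !inE eqxx !orbT.
have pb : b \in cell L i j by rewrite !inE eqxx !orbT.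
have pc : c \in cell L i j by rewrite !inE eqxx !orbT.
have pq : q \in cell L i j by rewrite !inE eqxx !orbT.
rewrite (le_trans (ler_normD _ _))//.
apply: (@le_trans _ _ (M * (d * d) + M * (d * d) + M * (d * d))); last first.
  by apply: ler_eq; ring.
apply: lerD; last exact: tri.
by rewrite (le_trans (ler_normD _ _))// lerD// tri.
Qed.

(** Summed over consecutive edges the pentagons telescope, and what remains of the
connecting segments are the two outer ones. *)
Lemma chain_refine L i a b : (a <= b)%N ->
  `|chain (L i.+1) (2 * a) (2 * b) - chain (L i) a b
    + omega (L i a) (L i.+1 (2 * a)%N) - omega (L i b) (L i.+1 (2 * b)%N)|
  <= M * (3 * \sum_(a <= j < b) width (cell L i j) ^+ 2).
Proof.
move=> /subnKC <-; elim: (b - a)%N => [|k IH].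
  by rewrite addn0 /chain !big_geq// subrr add0r subrr normr0 !mulr0.
set c := (a + k)%N in IH *; rewrite addnS.
have ac : (a <= c)%N by rewrite leq_addr.
have -> : chain (L i.+1) (2 * a) (2 * c.+1) = chain (L i.+1) (2 * a) (2 * c)
    + (omega (L i.+1 (2 * c)%N) (L i.+1 (2 * c + 1)%N)
    + omega (L i.+1 (2 * c + 1)%N) (L i.+1 (2 * c + 2)%N)).
  rewrite /chain mulnS addnC addn2 !big_nat_recr/= ?addrA ?addn1 ?addn2//; lia.
have -> : chain (L i) a c.+1 = chain (L i) a c + omega (L i c) (L i c.+1).
  by rewrite /chain big_nat_recr.
rewrite big_nat_recr//= [3 * _]mulrDr [M * _]mulrDr.
have -> : (2 * c.+1)%N = (2 * c + 2)%N by lia.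
have := lerD IH (norm_pentagon L i c); apply: le_trans.
by apply: le_trans (ler_normD _ _); apply: ler_eq; congr `|_|; ring.
Qed.

(** The index [a'] of level [i.+1] may be odd, and then the refined chain starts or
ends one edge away from the refinement of its parent [a'./2]; this triangle is the
correction, and it is degenerate for even [a']. *)
Lemma norm_half_triangle L i a' (a := a'./2) (d := width (cell L i a)) :
  `|omega (L i.+1 a') (L i.+1 (2 * a)%N) + omega (L i.+1 (2 * a)%N) (L i a)
   + omega (L i a) (L i.+1 a')| <= M * d ^+ 2.
Proof.
have a'E : (a' = 2 * a \/ a' = 2 * a + 1)%N by rewrite /a; lia.
have aC : L i.+1 a' \in cell L i a by case: a'E => ->; rewrite !inE eqxx !orbT.
by apply: norm_omega_triangle; apply: le_width => //; rewrite !inE eqxx ?orbT.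
Qed.

(** Passing to the next level changes the excess by the pentagons between the two
chains, one triangle at each end, and the quadrilateral between the two chords.
Only the last is not controlled by squares of widths. *)
Lemma excess_step L i a' b' (a := a'./2) (b := b'./2)
    (d := fun j => width (cell L i j)) : (a' <= b')%N ->
  `|excess (L i.+1) a' b' - excess (L i) a b
    - quad (L i a) (L i b) (L i.+1 b') (L i.+1 a')|
  <= M * (3 * (\sum_(a <= j < b) d j ^+ 2) + d a ^+ 2 + d b ^+ 2).
Proof.
move=> ab'; have ab : (a <= b)%N by rewrite /a /b; lia.
have sub c' : chain (L i.+1) (2 * c'./2) c' = omega (L i.+1 (2 * c'./2)%N) (L i.+1 c').
  have [e|e] : (c' = 2 * c'./2 \/ c' = (2 * c'./2).+1)%N by lia.
    by rewrite /chain -e big_geq// omegavv.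
  by rewrite {2}e /chain big_nat1 -e.
have E : chain (L i.+1) a' b' = chain (L i.+1) (2 * a) (2 * b)
    - omega (L i.+1 (2 * a)%N) (L i.+1 a') + omega (L i.+1 (2 * b)%N) (L i.+1 b').
  have aa' : (2 * a <= a')%N by rewrite /a; lia.
  have bb' : (2 * b <= b')%N by rewrite /b; lia.
  have a2b : (2 * a <= 2 * b)%N by rewrite leq_mul2l.
  rewrite -!sub -/a -/b.
  have := chain_cat (L i.+1) aa' ab'; have := chain_cat (L i.+1) a2b bb'; lra.
have := chain_refine L i ab; have := norm_half_triangle L i a'.
have := norm_half_triangle L i b'; rewrite -/a -/b -/(d a) -/(d b) => Tb Ta P.
have := lerD (lerD P Ta) Tb.
rewrite -!mulrDr; apply: le_trans.
rewrite [X in `|X|](_ : _ =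
   (chain (L i.+1) (2 * a) (2 * b) - chain (L i) a b
    + omega (L i a) (L i.+1 (2 * a)%N) - omega (L i b) (L i.+1 (2 * b)%N))
   + (omega (L i.+1 a') (L i.+1 (2 * a)%N) + omega (L i.+1 (2 * a)%N) (L i a)
   + omega (L i a) (L i.+1 a'))
   - (omega (L i.+1 b') (L i.+1 (2 * b)%N) + omega (L i.+1 (2 * b)%N) (L i b)
   + omega (L i b) (L i.+1 b'))).
  by rewrite (le_trans (ler_normB _ _))// lerD// ler_normD.
rewrite /excess /quad E (omegaC (L i.+1 a') (L i.+1 (2 * a)%N)).
rewrite (omegaC (L i.+1 b') (L i.+1 (2 * b)%N)) (omegaC (L i a) (L i.+1 (2 * a)%N)).
rewrite (omegaC (L i b) (L i.+1 (2 * b)%N)) (omegaC (L i.+1 a') (L i.+1 b')).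
rewrite (omegaC (L i.+1 a') (L i a)); ring.
Qed.

(** The form of the bound is chosen to telescope: with [D] the sum of all earlier
displacements [e], the bounds of successive levels add up to a difference of two
squares. *)
Lemma norm_quad (u v v' u' : V) D e : `|v - u| <= D -> `|u' - u| + `|v' - v| <= e ->
  `|quad u v v' u'| <= M * ((D + e) ^+ 2 - D ^+ 2).
Proof.
move=> uv uve; have D0 : 0 <= D by rewrite (le_trans _ uv).
have e0 : 0 <= e by rewrite (le_trans _ uve)// addr_ge0.
have -> : quad u v v' u' = omega (v - u) (v' - v) + omega (v' - u) (u' - u).
  rewrite /quad !(omegaBl, omegaBr) !omegavv.
  rewrite (omegaC v' u) (omegaC u u') (omegaC v u); ring.
have v'u : `|v' - u| <= D + `|v' - v|.
  by rewrite -[v' - u](subrKA v) addrC (le_trans (ler_normD _ _))// lerD.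
have := norm_omega_le uv (lexx `|v' - v|).
have := norm_omega_le v'u (lexx `|u' - u|) => H1 H2.
rewrite (le_trans (ler_normD _ _))// (le_trans (lerD H2 H1))// -mulrDr.
rewrite ler_wpM2l ?omega_bound_ge0//.
have := normr_ge0 (v' - v); have := normr_ge0 (u' - u).
move: uve; move: `|v' - v| `|u' - u| => x y; nra.
Qed.
End Excess.

(** * Adding up the scales *)

Section RealSums.
Context {R : realType}.
Implicit Types e : nat -> R.

Lemma sqr_sum_le e a b :
  (\sum_(a <= i < b) e i) ^+ 2 <= (b - a)%:R * \sum_(a <= i < b) e i ^+ 2.
Proof.
have [ba|/ltnW/subnKC <-] := leqP b a.
  by rewrite !big_geq// expr0n mulr0.
rewrite addKn; elim: (b - a)%N => [|k IH].
  by rewrite addn0 !big_geq// expr0n mulr0.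
rewrite addnS !big_nat_recr ?leq_addr//=.
set X := \sum_(_ <= _ < _) e _ in IH *; set Y := \sum_(_ <= _ < _) e _ ^+ 2 in IH *.
set x := e _; case: k => [|k] in X Y x IH *.
  have X0 : X = 0 by rewrite /X addn0 big_geq.
  have Y0 : Y = 0 by rewrite /Y addn0 big_geq.
  by rewrite X0 Y0 !add0r mul1r.
have k0 : 0 < k.+1%:R :> R by [].
have : 0 <= (k.+1%:R)^-1 * (X - k.+1%:R * x) ^+ 2.
  by rewrite mulr_ge0 ?sqr_ge0// invr_ge0.
have -> : (k.+1%:R)^-1 * (X - k.+1%:R * x) ^+ 2 =
   k.+1%:R^-1 * X ^+ 2 - 2 * X * x + k.+1%:R * x ^+ 2.
  by field; rewrite gt_eqF.
have : k.+1%:R^-1 * X ^+ 2 <= Y by rewrite mulrC ler_pdivrMr// mulrC.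
rewrite -(natr1 k.+1); move: IH; clearbody X Y x.
by move: k.+1%:R k.+1%:R^-1 => z w; nra.
Qed.

(** The ratio [2 ^ (-1/2)] at which the widths decay from one level to the next. *)
Definition halfroot : R := Num.sqrt 2^-1.

Lemma halfroot_ge0 : 0 <= halfroot. Proof. exact: sqrtr_ge0. Qed.

Lemma sqr_halfroot : halfroot ^+ 2 = 2^-1.
Proof. by rewrite sqr_sqrtr// invr_ge0. Qed.

Lemma halfroot_le : halfroot <= 3 / 4.
Proof.
have := sqr_halfroot; have := halfroot_ge0; move: halfroot => x; nra.
Qed.

Lemma sum_halfroot_le a b :
  (a <= b)%N -> \sum_(a <= i < b) halfroot ^+ i <= 4 * halfroot ^+ a - 4 * halfroot ^+ b.
Proof.
move=> /subnKC <-; elim: (b - a)%N => [|k IH].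
  by rewrite addn0 big_geq// subrr.
rewrite addnS big_nat_recr ?leq_addr//= exprS.
have := halfroot_le; have : 0 <= halfroot ^+ (a + k) by rewrite exprn_ge0// halfroot_ge0.
nra.
Qed.

(** Splitting at the index [i0 + N] and using Cauchy-Schwarz below it and the
geometric decay above it trades the number of terms for a small error; choosing
[N] is what produces the logarithm. *)
Lemma sqr_sum_decay e kappa i0 m N : 0 <= kappa ->
  (forall i, 0 <= e i <= kappa * halfroot ^+ i) ->
  (\sum_(i0 <= i < m) e i) ^+ 2 <=
    2 * (N%:R * \sum_(i0 <= i < m) e i ^+ 2 + 16 * kappa ^+ 2 * 2^-1 ^+ (i0 + N)).
Proof.
move=> k0 He; set S := \sum_(_ <= _ < _) _ ^+ 2.
have S0 x y : 0 <= \sum_(x <= i < y) e i ^+ 2 by apply: sumr_ge0 => i _; exact: sqr_ge0.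
have T0 : 0 <= 16 * kappa ^+ 2 * 2^-1 ^+ (i0 + N).
  by rewrite mulr_ge0 ?exprn_ge0// mulr_ge0// exprn_ge0.
have [mN|Nm] := leqP m (i0 + N).
  apply: (le_trans (sqr_sum_le _ _ _)).
  have : (m - i0)%:R * S <= N%:R * S by rewrite ler_wpM2r ?S0// ler_nat leq_subLR.
  have : 0 <= N%:R * S by rewrite mulr_ge0 ?S0.
  rewrite -/S; lra.
have iN : (i0 <= i0 + N)%N by rewrite leq_addr.
have SE : S = \sum_(i0 <= i < i0 + N) e i ^+ 2 + \sum_(i0 + N <= i < m) e i ^+ 2.
  by rewrite /S (big_cat_nat iN (ltnW Nm)).
rewrite (big_cat_nat iN (ltnW Nm))/=.
have A := sqr_sum_le e i0 (i0 + N); rewrite addKn in A.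
have B0 : 0 <= \sum_(i0 + N <= i < m) e i by apply: sumr_ge0 => i _; case/andP: (He i).
have B : \sum_(i0 + N <= i < m) e i <= kappa * (4 * halfroot ^+ (i0 + N)).
  apply: (@le_trans _ _ (\sum_(i0 + N <= i < m) kappa * halfroot ^+ i)).
    by apply: ler_sum => i _; case/andP: (He i).
  rewrite -mulr_sumr ler_wpM2l// (le_trans (sum_halfroot_le (ltnW Nm)))//.
  by rewrite gerBl mulr_ge0// exprn_ge0// halfroot_ge0.
have B2 : (\sum_(i0 + N <= i < m) e i) ^+ 2 <= 16 * kappa ^+ 2 * 2^-1 ^+ (i0 + N).
  have := lerXn2r 2 B0 (le_trans B0 B) B; move/le_trans; apply.
  by rewrite -sqr_halfroot -exprM mulnC exprM !exprMn; lra.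
have : N%:R * \sum_(i0 <= i < i0 + N) e i ^+ 2 <= N%:R * S.
  by rewrite ler_wpM2l// SE lerDl.
move: A B2; move: (\sum_(_ <= _ < _) e _) => x; move: (\sum_(_ <= _ < _) e _) => y.
have := sqr_ge0 (x - y); nra.
Qed.
End RealSums.

Section Multiscale.
Context {R : realType} {n : nat}.
Local Notation V := 'rV[R]_(n * 2).
Local Notation M := (omega_bound R n).
Variables (L : nat -> nat -> V) (a b : nat -> nat) (i0 : nat).
Hypothesis aE : forall i, (a i.+1)./2 = a i.
Hypothesis bE : forall i, (b i.+1)./2 = b i.
Hypothesis ab : forall i, (i0 <= i)%N -> (a i < b i)%N.

Let d i j := width (cell L i j).

(** The squared widths of the cells met by the edges from [x] to [y]. Each cell is
taken along with its right neighbour so that both end points are covered, and the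
bands of adjacent ranges add up. *)
Definition band (i x y : nat) : R :=
  \sum_(x <= j < y) (width (cell L i j) ^+ 2 + width (cell L i j.+1) ^+ 2).

Lemma band_ge0 i x y : 0 <= band i x y.
Proof. by apply: sumr_ge0 => j _; rewrite addr_ge0// sqr_ge0. Qed.

Lemma band_ends i x y : (x < y)%N -> d i x ^+ 2 + d i y ^+ 2 <= band i x y.
Proof.
case: y => // y; rewrite ltnS /band => xy.
rewrite big_split/= lerD//.
  by rewrite big_ltn// lerDl sumr_ge0// => j _; exact: sqr_ge0.
by rewrite big_nat_recr//= lerDr sumr_ge0// => j _; exact: sqr_ge0.
Qed.

Definition drift i : R :=
  `|L i.+1 (a i.+1) - L i (a i)| + `|L i.+1 (b i.+1) - L i (b i)|.

Let half_cell c i : (c i.+1)./2 = c i -> `|L i.+1 (c i.+1) - L i (c i)| <= d i (c i).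
Proof.
move=> cE; apply: le_width; last by rewrite inE eqxx.
have [->| ->] : (c i.+1 = 2 * c i \/ c i.+1 = 2 * c i + 1)%N by lia.
all: by rewrite !inE eqxx !orbT.
Qed.

Lemma drift_ge0 i : 0 <= drift i. Proof. exact: addr_ge0. Qed.

Lemma drift_le i : drift i <= d i (a i) + d i (b i).
Proof. by apply: lerD; exact: half_cell. Qed.

Lemma sqr_drift_le i : (i0 <= i)%N -> drift i ^+ 2 <= 2 * band i (a i) (b i).
Proof.
move=> /ab/(band_ends i); have := drift_le i; have := drift_ge0 i.
have := width_ge0 (cell L i (a i)); have := width_ge0 (cell L i (b i)).
rewrite -/(d i (a i)) -/(d i (b i)).
move: (d _ _) (d _ _) => x y y0 x0 e0 exy xyB.
apply: (@le_trans _ _ ((x + y) ^+ 2)).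
  by rewrite lerXn2r// nnegrE ?addr_ge0.
by have := sqr_ge0 (x - y); nra.
Qed.

Let step_bound i : (i0 <= i)%N ->
  3 * (\sum_(a i <= j < b i) d i j ^+ 2) + d i (a i) ^+ 2 + d i (b i) ^+ 2
  <= 4 * band i (a i) (b i).
Proof.
move=> i0i; have := band_ends i (ab i0i).
have : \sum_(a i <= j < b i) d i j ^+ 2 <= band i (a i) (b i).
  by apply: ler_sum => j _; rewrite lerDl sqr_ge0.
lra.
Qed.

(** [norm_quad] is applied at each level with the initial chord plus all drifts so far
as the bound on the chord. *)
Lemma excess_variation m D : (i0 <= m)%N -> `|L i0 (b i0) - L i0 (a i0)| <= D ->
  \sum_(i0 <= i < m) `|excess (L i.+1) (a i.+1) (b i.+1) - excess (L i) (a i) (b i)|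
  <= M * (4 * (\sum_(i0 <= i < m) band i (a i) (b i))
          + (D + \sum_(i0 <= i < m) drift i) ^+ 2 - D ^+ 2).
Proof.
move=> + D0; move=> /subnKC <-.
suff [] : \sum_(i0 <= i < i0 + (m - i0))
    `|excess (L i.+1) (a i.+1) (b i.+1) - excess (L i) (a i) (b i)|
    <= M * (4 * (\sum_(i0 <= i < i0 + (m - i0)) band i (a i) (b i))
          + (D + \sum_(i0 <= i < i0 + (m - i0)) drift i) ^+ 2 - D ^+ 2) /\
  (let i := (i0 + (m - i0))%N in `|L i (b i) - L i (a i)| <=
    D + \sum_(i0 <= i < i0 + (m - i0)) drift i) by [].
elim: (m - i0)%N => [|k [IH1 IH2]].
  by rewrite addn0 !big_geq// mulr0 add0r addr0 subrr mulr0.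
rewrite addnS !big_nat_recr ?leq_addr//=; set i := (i0 + k)%N in IH1 IH2 *.
have i0i : (i0 <= i)%N by rewrite leq_addr.
split; last first.
  set u := L i (a i); set v := L i (b i); set u' := L _ _; set v' := L _ _.
  have -> : u' - v' = (v - u) + ((u' - v) - (v' - u)) by rewrite opprB addrCA !subrKA.
  rewrite [leRHS]addrA (le_trans (ler_normD _ _))//; apply: lerD => //.
  by rewrite (le_trans (ler_normB _ _))// addrC.
have step := @excess_step _ _ L i (a i.+1) (b i.+1) (ltnW (ab (leqW i0i))).
rewrite aE bE in step.
have Q := norm_quad IH2 (lexx (drift i)).
have H : `|excess (L i.+1) (a i.+1) (b i.+1) - excess (L i) (a i) (b i)| <=
  M * (4 * band i (a i) (b i)) +
  M * ((D + \sum_(i0 <= l < i) drift l + drift i) ^+ 2 -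
       (D + \sum_(i0 <= l < i) drift l) ^+ 2).
  rewrite -[X in `|X|](subrK (quad (L i (a i)) (L i (b i)) (L i.+1 (b i.+1))
    (L i.+1 (a i.+1)))).
  apply: (le_trans (ler_normD _ _)); apply: lerD => //.
  apply: (le_trans step); rewrite ler_wpM2l ?omega_bound_ge0//.
  exact: step_bound.
by apply: (le_trans (lerD IH1 H)); rewrite -!mulrDr ler_wpM2l ?omega_bound_ge0//; nra.
Qed.


Lemma excess_sub m : (i0 <= m)%N ->
  `|excess (L m) (a m) (b m) - excess (L i0) (a i0) (b i0)|
  <= \sum_(i0 <= i < m) `|excess (L i.+1) (a i.+1) (b i.+1) - excess (L i) (a i) (b i)|.
Proof.
move=> i0m; rewrite -(telescope_sumr (fun i => excess (L i) (a i) (b i)) i0m).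
exact: ler_norm_sum.
Qed.

(** When the quadrilaterals vanish, squares of widths alone bound the change, uniformly
in the number of scales. *)
Lemma excess_sub_noquad m : (i0 <= m)%N ->
  (forall i, quad (L i (a i)) (L i (b i)) (L i.+1 (b i.+1)) (L i.+1 (a i.+1)) = 0) ->
  `|excess (L m) (a m) (b m) - excess (L i0) (a i0) (b i0)|
  <= M * (4 * \sum_(i0 <= i < m) band i (a i) (b i)).
Proof.
move=> i0m q0; apply: (le_trans (excess_sub i0m)).
rewrite mulr_sumr mulr_sumr big_nat [leRHS]big_nat; apply: ler_sum => i /andP[i0i _].
have := @excess_step _ _ L i (a i.+1) (b i.+1) (ltnW (ab (leqW i0i))).
rewrite aE bE q0 subr0 => /le_trans; apply.
by rewrite ler_wpM2l ?omega_bound_ge0//; exact: step_bound.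
Qed.

Variable K : R.
Hypothesis K0 : 0 <= K.
Hypothesis dK : forall i j, width (cell L i j) <= K * halfroot ^+ i.

(** The sum of the drifts is estimated by [sqr_sum_decay], as their squares are
dominated by the bands. *)
Lemma variation_bound m N D :
  (i0 <= m)%N -> `|L i0 (b i0) - L i0 (a i0)| <= D ->
  D ^+ 2 <= 2 * (\sum_(i0 <= i < m) band i (a i) (b i)) ->
  \sum_(i0 <= i < m) `|excess (L i.+1) (a i.+1) (b i.+1) - excess (L i) (a i) (b i)|
  <= M * ((8 + 8 * N%:R) * (\sum_(i0 <= i < m) band i (a i) (b i))
          + 256 * K ^+ 2 * 2^-1 ^+ (i0 + N)).
Proof.
set S := \sum_(_ <= _ < _) band _ _ _; move=> i0m uv D2.
apply: (le_trans (excess_variation i0m uv)).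
rewrite ler_wpM2l ?omega_bound_ge0// -/S.
have driftK i : 0 <= drift i <= 2 * K * halfroot ^+ i.
  rewrite drift_ge0/= (le_trans (drift_le i))//.
  by have := dK i (a i); have := dK i (b i); rewrite /d; lra.
have K20 : 0 <= 2 * K by rewrite mulr_ge0.
have := @sqr_sum_decay _ drift (2 * K) i0 m N K20 driftK.
have : \sum_(i0 <= i < m) drift i ^+ 2 <= 2 * S.
  rewrite mulr_sumr big_nat [leRHS]big_nat; apply: ler_sum => i /andP[i0i _].
  exact: sqr_drift_le.
move=> /(ler_wpM2l (ler0n R N)).
move: (\sum_(_ <= _ < _) drift _) (\sum_(_ <= _ < _) drift _ ^+ 2) => E E2.
move: (2^-1 ^+ (i0 + N)) (N%:R : R) => eta N' H1 H2.
have := sqr_ge0 (D - E); nra.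
Qed.

(** The cost of starting at level [i0] with at most two edges: their triangle is
itself controlled by the band of that level, and so is the first chord. *)
Lemma excess_bound m N : (i0 < m)%N -> (b i0 <= a i0 + 2)%N ->
  `|excess (L m) (a m) (b m)|
  <= M * ((9 + 8 * N%:R) * \sum_(i0 <= i < m) band i (a i) (b i)
          + 256 * K ^+ 2 * 2^-1 ^+ (i0 + N)).
Proof.
set S := \sum_(_ <= _ < _) _; move=> i0m ba; have ab0 := ab (leqnn i0).
have B : band i0 (a i0) (b i0) <= S.
  by rewrite /S big_ltn// lerDl sumr_ge0// => i _; exact: band_ge0.
have wd j : `|L i0 j.+1 - L i0 j| <= d i0 j.
  by apply: le_width; rewrite !inE eqxx ?orbT.
have [[D [uv D2]] ex0] : (exists D, `|L i0 (b i0) - L i0 (a i0)| <= D /\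
     D ^+ 2 <= 2 * band i0 (a i0) (b i0)) /\
    `|excess (L i0) (a i0) (b i0)| <= M * band i0 (a i0) (b i0).
  have [e|e] : (b i0 = (a i0).+1 \/ b i0 = (a i0).+2)%N by lia.
    split.
      exists (d i0 (a i0)); rewrite e; split; first exact: wd.
      rewrite /band big_nat1 -/(d _ _) -/(d i0 (a i0).+1).
      have := sqr_ge0 (d i0 (a i0)); have := sqr_ge0 (d i0 (a i0).+1); lra.
    rewrite e /excess /chain big_nat1 subrr normr0 mulr_ge0 ?omega_bound_ge0//.
    exact: band_ge0.
  have bE2 : band i0 (a i0) (a i0).+2 = d i0 (a i0) ^+ 2 + d i0 (a i0).+1 ^+ 2
      + (d i0 (a i0).+1 ^+ 2 + d i0 (a i0).+2 ^+ 2).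
    by rewrite /band big_nat_recr//= big_nat1.
  split.
    exists (d i0 (a i0) + d i0 (a i0).+1); rewrite e bE2; split.
      rewrite -(subrKA (L i0 (a i0).+1)) [leRHS]addrC.
      by apply: (le_trans (ler_normD _ _)); apply: lerD; exact: wd.
    have := sqr_ge0 (d i0 (a i0) - d i0 (a i0).+1).
    have := sqr_ge0 (d i0 (a i0).+2); have := sqr_ge0 (d i0 (a i0).+1); nra.
  rewrite e bE2 /excess /chain big_nat_recr//= big_nat1.
  rewrite -(omegaC (L i0 (a i0)) (L i0 (a i0).+2)) omega_triangle.
  rewrite -[L i0 (a i0).+2 - _](subrKA (L i0 (a i0).+1)) omegaDr omegavv addr0.
  apply: (le_trans (norm_omega_le (wd _) (wd _))).
  rewrite ler_wpM2l ?omega_bound_ge0//.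
  have := sqr_ge0 (d i0 (a i0) - d i0 (a i0).+1).
  have := sqr_ge0 (d i0 (a i0).+2); have := sqr_ge0 (d i0 (a i0).+1); nra.
have D2S : D ^+ 2 <= 2 * S by rewrite (le_trans D2)// ler_wpM2l.
have := variation_bound N (ltnW i0m) uv D2S.
have := excess_sub (ltnW i0m).
have := ler_wpM2l (@omega_bound_ge0 R n) B.
have := lerB_dist (excess (L m) (a m) (b m)) (excess (L i0) (a i0) (b i0)).
rewrite -/S; lra.
Qed.
End Multiscale.

(** * Excess over the intervals of a subdivision *)

Section Dyadic.
Context {R : realType}.
Implicit Types s t x : R.

Definition dyadic (i : nat) t : nat := Num.truncn (2 ^+ i * t).

Lemma dyadic_itv i t : 0 <= t -> (dyadic i t)%:R <= 2 ^+ i * t < (dyadic i t).+1%:R.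
Proof. by move=> t0; apply: truncn_itv; rewrite mulr_ge0// exprn_ge0. Qed.

Lemma dyadic_half i t : 0 <= t -> (dyadic i.+1 t)./2 = dyadic i t.
Proof.
move=> t0; apply/esym/truncn_def.
have /andP[lo hi] := dyadic_itv i.+1 t0.
rewrite exprS in lo hi.
have E : (dyadic i.+1 t = 2 * (dyadic i.+1 t)./2 + odd (dyadic i.+1 t))%N by lia.
move: lo hi; rewrite {1 2}E -!natr1 natrD natrM.
have : 0 <= ((odd (dyadic i.+1 t))%:R : R) <= 1 by case: odd; rewrite ?lexx ?ler01.
by move=> ?; lra.
Qed.

Lemma dyadic_le i s t : s <= t -> (dyadic i s <= dyadic i t)%N.
Proof. by move=> st; apply: le_truncn; rewrite ler_pM2l// exprn_gt0. Qed.

Lemma dyadic0 i : dyadic i 0 = 0%N.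
Proof. by rewrite /dyadic mulr0 truncn0. Qed.

Lemma dyadic1 i : dyadic i 1 = (2 ^ i)%N.
Proof. by rewrite /dyadic mulr1 -natrX natrK. Qed.

Lemma dyadic_lt i s t : 0 <= s -> 2 ^- i <= t - s -> (dyadic i s < dyadic i t)%N.
Proof.
move=> s0 st; have i0 : 0 < 2 ^- i :> R by rewrite invr_gt0 exprn_gt0.
have t0 : 0 <= t by lra.
have /andP[lo _] := dyadic_itv i s0; have /andP[_ hi] := dyadic_itv i t0.
have : 1 <= 2 ^+ i * (t - s) by rewrite -ler_pdivrMl ?exprn_gt0// mulr1.
rewrite mulrBr => H; rewrite -ltnS -(ltr_nat R) -natr1; lra.
Qed.

Lemma dyadic_le2 i s t : 0 <= s <= t -> t - s < 2 * 2 ^- i ->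
  (dyadic i t <= dyadic i s + 2)%N.
Proof.
move=> /andP[s0 st] ts; have t0 : 0 <= t by lra.
have /andP[_ hi] := dyadic_itv i s0; have /andP[lo _] := dyadic_itv i t0.
have : 2 ^+ i * (t - s) < 2 by rewrite -ltr_pdivlMl ?exprn_gt0// mulrC.
rewrite mulrBr => H; rewrite -ltnS -(ltr_nat R) -addSn natrD; lra.
Qed.

Lemma pow2V_lt x : 0 < x -> exists i, 2 ^- i < x.
Proof.
move=> x0; have := archi_boundP (ltW (_ : 0 < x^-1)); rewrite invr_gt0 => /(_ x0) H.
exists (Num.Def.archi_bound x^-1).
rewrite invf_plt ?posrE ?exprn_gt0// (lt_trans H)// -natrX ltr_nat.
exact: ltn_expl.
Qed.

(** The scale of an interval of length [x]. *)
Lemma pow2V_level x : 0 < x <= 1 -> exists i, 2 ^- i <= x < 2 * 2 ^- i.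
Proof.
move=> /andP[x0 x1].
have exi : exists i, 2 ^- i <= x by have [i /ltW] := pow2V_lt x0; exists i.
case: (ex_minnP exi) => [[|i]] Hi mini.
  by exists 0%N; rewrite Hi expr0 invr1 mulr1; lra.
exists i.+1; rewrite Hi exprS invfM mulrA mulfV// mul1r ltNge; apply/negP => /mini.
by rewrite ltnn.
Qed.
End Dyadic.

Section DyadicExcess.
Context {R : realType} {n : nat}.
Local Notation V := 'rV[R]_(n * 2).
Local Notation M := (omega_bound R n).
Variables (L : nat -> nat -> V) (K : R).
Hypothesis K0 : 0 <= K.
Hypothesis dK : forall i j, width (cell L i j) <= K * halfroot ^+ i.

Lemma band_cat i x y z : (x <= y)%N -> (y <= z)%N ->
  band L i x z = band L i x y + band L i y z.
Proof. by move=> xy yz; rewrite /band (big_cat_nat xy yz). Qed.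

(** The chain over the interval from [s] to [t] is followed from the scale of [t - s],
where the two dyadic indices are distinct and at most two apart. The error term
[2 ^- i0] is then at most [t - s], which makes it summable over a subdivision. A
point has no scale, but its excess is zero. *)
Lemma interval_excess (s t : R) i1 N : 0 <= s <= t -> t <= 1 -> t - s < 2 ^- i1 ->
  exists m0, forall m, (m0 <= m)%N ->
  `|excess (L m) (dyadic m s) (dyadic m t)| <=
  M * ((9 + 8 * N%:R) * \sum_(i1 <= i < m) band L i (dyadic i s) (dyadic i t)
    + 256 * K ^+ 2 * 2 ^- N * (t - s)).
Proof.
move=> /andP[s0 st] t1 ts.
have [->|neq] := eqVneq s t.
  exists 0%N => m _; rewrite /excess /chain big_geq// omegavv subrr normr0.
  rewrite subrr mulr0 addr0 !mulr_ge0 ?omega_bound_ge0// sumr_ge0// => i _.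
  exact: band_ge0.
have {neq} st' : 0 < t - s by rewrite subr_gt0 lt_neqAle neq.
(* The index [i0] is the level from which the bound starts; it is above [i1] as the
interval is shorter than [2 ^- i1]. *)
have [i0 /andP[lo hi]] : exists i, 2 ^- i <= t - s < 2 * 2 ^- i.
  by apply: pow2V_level; rewrite st'; lra.
have i10 : (i1 <= i0)%N.
  rewrite leqNgt; apply/negP => /ltnW i01.
  suff : 2 ^- i1 <= 2 ^- i0 :> R by lra.
  by rewrite lef_pV2 ?posrE ?exprn_gt0// ler_eXn2l// ltr1n.
exists i0.+1 => m i0m.
have half (c : R) : 0 <= c -> forall i, (dyadic i.+1 c)./2 = dyadic i c.
  by move=> c0 i; exact: dyadic_half.
have t0 : 0 <= t by lra.
have lt i : (i0 <= i)%N -> (dyadic i s < dyadic i t)%N.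
  move=> i0i; apply: dyadic_lt => //; apply: le_trans lo.
  by rewrite lef_pV2 ?posrE ?exprn_gt0// ler_eXn2l// ltr1n.
have le2 : (dyadic i0 t <= dyadic i0 s + 2)%N by apply: dyadic_le2; rewrite ?s0.
have := excess_bound (half _ s0) (half _ t0) lt K0 dK N i0m le2.
move=> /le_trans; apply.
rewrite ler_wpM2l ?omega_bound_ge0// lerD//.
  rewrite ler_wpM2l ?addr_ge0 ?mulr_ge0// [leRHS](big_cat_nat i10 (ltnW i0m))/=.
  by rewrite lerDr sumr_ge0// => i _; exact: band_ge0.
rewrite exprD !exprVn mulrA mulrAC; apply: ler_wpM2l lo.
apply: mulr_ge0; first exact: mulr_ge0 (ler0n R 256) (sqr_ge0 K).
by rewrite invr_ge0 exprn_ge0.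
Qed.

(** Both terms of [interval_excess] are additive in the interval, so nothing is lost
in the sum. The order of [t 0] and [t p] is carried along for the induction. *)
Lemma partition_excess (t : nat -> R) p i1 N : 0 <= t 0%N -> t p <= 1 ->
  (forall k, (k < p)%N -> t k <= t k.+1 < t k + 2 ^- i1) ->
  exists m0, forall m, (m0 <= m)%N ->
  `|\sum_(0 <= k < p) excess (L m) (dyadic m (t k)) (dyadic m (t k.+1))| <=
  M * ((9 + 8 * N%:R) *
        \sum_(i1 <= i < m) band L i (dyadic i (t 0%N)) (dyadic i (t p))
    + 256 * K ^+ 2 * 2 ^- N * (t p - t 0%N)) /\ t 0%N <= t p.
Proof.
move=> t0; elim: p => [|p IH] tp tS.
  exists 0%N => m _; rewrite big_geq// normr0 subrr mulr0 addr0; split => //.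
  rewrite !mulr_ge0 ?omega_bound_ge0// sumr_ge0// => i _.
  exact: band_ge0.
have /andP[pS pS'] := tS p (ltnSn p).
have [|k kp|m0 H0] := IH; [by lra|by apply: tS; exact: leqW|].
have t0p : t 0%N <= t p by have [] := H0 m0 (leqnn _).
have [||m1 H1] := @interval_excess (t p) (t p.+1) i1 N _ tp; [lra|lra|].
exists (maxn m0 m1) => m; rewrite geq_max => /andP[/H0[{}H0 _] /H1{}H1].
split; last by lra.
rewrite big_nat_recr//= (le_trans (ler_normD _ _))// (le_trans (lerD H0 H1))//.
rewrite -mulrDr ler_wpM2l ?omega_bound_ge0//.
have -> : \sum_(i1 <= i < m) band L i (dyadic i (t 0%N)) (dyadic i (t p.+1)) =
  \sum_(i1 <= i < m) band L i (dyadic i (t 0%N)) (dyadic i (t p)) +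
  \sum_(i1 <= i < m) band L i (dyadic i (t p)) (dyadic i (t p.+1)).
  rewrite -big_split/=; apply: eq_bigr => i _.
  by rewrite (@band_cat i _ (dyadic i (t p)))// dyadic_le.
by apply: ler_eq; ring.
Qed.

(** The chains over the intervals join up, and the chords form the area sum of the
dyadic approximation at the subdivision points. *)
Lemma sum_excess (t : nat -> R) p m :
  (forall k, (k < p)%N -> t k <= t k.+1) ->
  let q s := L m (dyadic m s) in
  \sum_(0 <= k < p) excess (L m) (dyadic m (t k)) (dyadic m (t k.+1)) =
  chain (L m) (dyadic m (t 0%N)) (dyadic m (t p))
    - \sum_(0 <= k < p) omega (q (t k)) (q (t k.+1)).
Proof.
move=> tS q; rewrite /excess sumrB; congr (_ - _).
suff [] : t 0%N <= t p /\ \sum_(0 <= k < p) chain (L m) (dyadic m (t k)) (dyadic m (t k.+1))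
   = chain (L m) (dyadic m (t 0%N)) (dyadic m (t p)) by [].
elim: p tS => [|p IH] tS; first by rewrite /chain !big_geq.
have [k kp|t0p E] := IH; first by apply: tS; exact: leqW.
have pS := tS p (ltnSn p); split; first exact: le_trans pS.
by rewrite big_nat_recr//= E -chain_cat// dyadic_le.
Qed.
End DyadicExcess.

(** * Areas of concatenated curves *)

Section Areas.
Context {R : realType} {n : nat}.
Local Notation V := 'rV[R]_(n * 2).
Local Notation M := (omega_bound R n).
Implicit Types (a b c B eps eta : R) (g : R -> V).

(** Repeated points are allowed, so that truncating a subdivision at an intermediate
time, by [min] and by [max], gives subdivisions again. *)
Definition subdivision a b (eta : R) (p : nat) (t : nat -> R) : Prop :=
  [/\ t 0%N = a, t p = b & forall k, (k < p)%N -> t k <= t k.+1 < t k + eta].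

(** Twice the symplectic area, with respect to the more general subdivisions. *)
Definition doubled_area a b g B : Prop := forall eps, 0 < eps ->
  exists2 eta, 0 < eta & forall p t, subdivision a b eta p t ->
    `|B - \sum_(0 <= k < p) omega (g (t k)) (g (t k.+1))| < eps.

Lemma subdivision_mem a b eta p t : subdivision a b eta p t ->
  forall k, (k <= p)%N -> a <= t k <= b.
Proof.
case=> t0 tp tS.
have mono k l : (k <= l)%N -> (l <= p)%N -> t k <= t l.
  move=> /subnKC <-; elim: (l - k)%N => [|i IH]; first by rewrite addn0.
  rewrite addnS => kip; apply: le_trans (IH (ltnW kip)) _.
  by case/andP: (tS _ kip).
by move=> k kp; rewrite -t0 -tp !mono.
Qed.

Lemma eq_doubled_area a b g g' B : (forall t : R, a <= t <= b -> g t = g' t) ->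
  doubled_area a b g B -> doubled_area a b g' B.
Proof.
move=> gg' area eps /area[eta eta0 H]; exists eta => // p t tS.
rewrite (_ : \sum_(0 <= k < p) _ = \sum_(0 <= k < p) omega (g (t k)) (g (t k.+1))).
  exact: H.
apply: eq_big_nat => k kp; rewrite !gg' //; apply: (subdivision_mem tS) => //.
exact: ltnW.
Qed.

Lemma doubled_area_has_symplectic_area a b g B :
  doubled_area a b g B -> has_symplectic_area a b g (B / 2).
Proof.
move=> area eps eps0; have [|eta eta0 H] := area (2 * eps); first by rewrite mulr_gt0.
exists eta => // s [sp /eqP sb] smesh.
have /H : subdivision a b eta (size s) (nth b (a :: s)).
  split => //; first by rewrite -[RHS]sb (last_nth b).
  move=> k ks; rewrite (ltW (pathP b sp k ks))/= -ltrBlDl; apply: le_lt_trans smesh.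
  rewrite /mesh; apply: (le_bigmax_seq 0 k xpredT
    (fun k => nth b (a :: s) k.+1 - nth b (a :: s) k)) => //.
  by rewrite mem_index_iota.
rewrite /partition_area; move: (\sum_(_ <= _ < _) _) => S BS.
rewrite (_ : _ - _ = (B - S) / 2); last by field.
by rewrite normrM [`|2^-1|]ger0_norm// ltr_pdivrMr// mulrC.
Qed.

Definition left_cont a b g : Prop := forall eps, 0 < eps ->
  exists2 eta, 0 < eta & forall t, a <= t <= b -> b - t < eta -> `|g t - g b| <= eps.

Lemma left_cont_widen a a' b g : a < b -> left_cont a b g -> left_cont a' b g.
Proof.
move=> ab lc eps /lc[eta eta0 H]; exists (Num.min eta (b - a)).
  by rewrite lt_min eta0 subr_gt0.
move=> t /andP[_ tb]; rewrite lt_min => /andP[te ta]; apply: H => //.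
by rewrite tb; lra.
Qed.

(** Splitting every interval of a subdivision at [b] alters the sum only in the
interval that straddles [b]; the telescoping indicators of [b < t k] count it. *)
Lemma doubled_area_cat a b c g B1 B2 C : a <= b <= c ->
  left_cont a b g -> (forall t, b <= t <= c -> `|g t - g b| <= C) ->
  doubled_area a b g B1 -> doubled_area b c g B2 -> doubled_area a c g (B1 + B2).
Proof.
move=> /andP[ab bc] lc gC area1 area2 eps eps0.
have C0 : 0 <= C by rewrite (le_trans _ (gC b _))// lexx.
have e3 : 0 < eps / 3 by rewrite divr_gt0.
have MC : 0 < M * C + 1 by rewrite ltr_wpDl// mulr_ge0// omega_bound_ge0.
have [e1 e10 H1] := area1 _ e3; have [e2 e20 H2] := area2 _ e3.
have [|e4 e40 H4] := lc (eps / 3 / (M * C + 1)); first by rewrite divr_gt0.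
exists (Num.min e1 (Num.min e2 e4)); first by rewrite !lt_min e10 e20.
move=> p t tS; have tac := subdivision_mem tS; case: tS => t0 tp tS.
have tS' k : (k < p)%N -> [/\ t k <= t k.+1, t k.+1 < t k + e1,
    t k.+1 < t k + e2 & t k.+1 < t k + e4].
  by move=> /tS; rewrite -!ltrBlDl !lt_min => /andP[-> /and3P[-> -> ->]].
have {}H1 : `|B1 -
    \sum_(0 <= k < p) omega (g (Num.min (t k) b)) (g (Num.min (t k.+1) b))| < eps / 3.
  apply: H1; split; first by rewrite t0 min_l.
    by rewrite tp min_r.
  move=> k /tS'[? ? ? ?]; have [?|?] := leP (t k) b; have [?|?] := leP (t k.+1) b; lra.
have {}H2 : `|B2 -
    \sum_(0 <= k < p) omega (g (Num.max (t k) b)) (g (Num.max (t k.+1) b))| < eps / 3.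
  apply: H2; split; first by rewrite t0 max_r.
    by rewrite tp max_l.
  move=> k /tS'[? ? ? ?]; have [?|?] := leP (t k) b; have [?|?] := leP (t k.+1) b; lra.
set S1 := \sum_(_ <= _ < _) _ in H1; set S2 := \sum_(_ <= _ < _) _ in H2.
set S := \sum_(_ <= _ < _) _.
suff : `|S - (S1 + S2)| <= eps / 3.
  move: H1 H2; rewrite !ltr_norml !ler_norml => *; lra.
rewrite /S /S1 /S2 -big_split -sumrB /=.
apply: (le_trans (ler_norm_sum _ _ _)).
pose ind (k : nat) : R := (b < t k)%R%:R.
apply: (@le_trans _ _ (\sum_(0 <= k < p) (eps / 3) * (ind k.+1 - ind k))); last first.
  rewrite -mulr_sumr telescope_sumr// ler_piMr ?(ltW e3)// /ind.
  by case: (b < t p); case: (b < t 0%N); rewrite ?subrr ?subr0 ?sub0r ?ler01// lerN10.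
rewrite big_nat [leRHS]big_nat; apply: ler_sum => k /andP[_ kp].
have [tt _ _ tt4] := tS' k kp.
rewrite /ind; have [kb|kb] := leP (t k) b; have [k1b|k1b] := leP (t k.+1) b.
- by rewrite omegavv addr0 subrr normr0 subrr mulr0.
- rewrite subr0 mulr1 -normrN.
  rewrite (_ : - _ = omega (g b) (g (t k.+1)) + omega (g (t k.+1)) (g (t k))
     + omega (g (t k)) (g b)); last by rewrite (omegaC (g (t k))); ring.
  have /andP[atk _] := tac k (ltnW kp); have /andP[_ tkc] := tac k.+1 kp.
  apply: (le_trans (norm_omega_triangle (a := C) (b := eps / 3 / (M * C + 1)) _ _)).
  + by apply: gC; rewrite (ltW k1b).
  + by apply: H4; [rewrite atk|lra].
  rewrite mulrA mulrCA -[leRHS]mulr1 ler_wpM2l ?(ltW e3)// ler_pdivrMr// mul1r.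
  by rewrite lerDl.
- lra.
- by rewrite omegavv add0r subrr normr0 subrr mulr0.
Qed.

Definition on_segment a b g (p q : V) : Prop :=
  forall t, a <= t <= b -> g t = segment p q ((t - a) / (b - a)).

Lemma segmentB (p q : V) x y : segment p q x - segment p q y = (x - y) *: (q - p).
Proof.
rewrite /segment !scalerBl !scale1r scalerBr.
apply/rowP => i; rewrite !mxE; ring.
Qed.

Lemma segment0 (p q : V) : segment p q 0 = p.
Proof. by rewrite /segment subr0 scale1r scale0r addr0. Qed.

Lemma segment1 (p q : V) : segment p q 1 = q.
Proof. by rewrite /segment subrr scale1r scale0r add0r. Qed.

Lemma omega_segment (p q : V) x y :
  omega (segment p q x) (segment p q y) = (y - x) * omega p q.
Proof.
rewrite /segment !(omegaDl, omegaDr, omegaZl, omegaZr) !omegavv (omegaC p q); ring.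
Qed.

Section OnSegment.
Variables (a b : R) (g : R -> V) (p q : V).
Hypotheses (ab : a < b) (gpq : on_segment a b g p q).

Lemma doubled_area_segment : doubled_area a b g (omega p q).
Proof.
move=> eps eps0; exists 1 => // m t tS; have tab := subdivision_mem tS.
rewrite (_ : \sum_(0 <= k < m) _ =
  \sum_(0 <= k < m) ((t k.+1 - a) / (b - a) * omega p q - (t k - a) / (b - a) * omega p q)).
  rewrite (telescope_sumr (fun k => (t k - a) / (b - a) * omega p q))//.
  case: tS => -> -> _; rewrite subrr mul0r mul0r subr0 divff; last by rewrite gt_eqF ?subr_gt0.
  by rewrite mul1r subrr normr0.
apply: eq_big_nat => k km; rewrite !gpq ?tab//; last exact: ltnW.
by rewrite omega_segment mulrBl.
Qed.

Lemma on_segment_left_cont : left_cont a b g.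
Proof.
move=> eps eps0; have ba : 0 < b - a by rewrite subr_gt0.
exists (eps * (b - a) / (`|q - p| + 1)).
  by rewrite divr_gt0 ?mulr_gt0// ltr_wpDl.
move=> t tab; rewrite ltr_pdivlMr ?ltr_wpDl// => H.
rewrite !gpq//; last by rewrite lexx ltW.
rewrite segmentB -mulrBl normrZ normrM.
rewrite [`|(b - a)^-1|]gtr0_norm ?invr_gt0// mulrAC ler_pdivrMr// opprB subrKA.
case/andP: tab => _ tb; rewrite distrC ger0_norm ?subr_ge0//.
have := normr_ge0 (q - p); nra.
Qed.

Lemma on_segment_bounded t : a <= t <= b -> `|g t - g a| <= `|q - p|.
Proof.
move=> tab; rewrite !gpq//; last by rewrite lexx ltW.
rewrite segmentB subrr mul0r subr0 normrZ.
rewrite ler_piMl// ger0_norm; case/andP: tab => ta tb.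
  by rewrite ler_pdivrMr ?mul1r ?subr_gt0//; lra.
by rewrite divr_ge0//; lra.
Qed.
End OnSegment.

Lemma polyline_on_segment N (p : nat -> V) j : (0 < N)%N ->
  on_segment (j%:R / N%:R) (j.+1%:R / N%:R) (polyline N p) (p j) (p j.+1).
Proof.
move=> N0 t; have N0' : 0 < N%:R :> R by rewrite ltr0n.
rewrite ler_pdivrMr// ler_pdivlMr// [t * _]mulrC => /andP[jt tj].
have -> : (t - j%:R / N%:R) / (j.+1%:R / N%:R - j%:R / N%:R) = N%:R * t - j%:R.
  by rewrite -mulrBl -natr1 addrAC subrr add0r mul1r invrK mulrBl divfK ?gt_eqF// mulrC.
rewrite /polyline; have [tj'|tj'|->] := ltgtP (N%:R * t) (j.+1%:R : R); last first.
- by rewrite natrK subrr segment0 -natr1 addrAC subrr add0r segment1.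
- by move: (lt_le_trans tj' tj); rewrite ltxx.
by rewrite (truncn_def (n := j))// jt.
Qed.

Lemma polyline_left_cont N (p : nat -> V) j : (0 < N)%N ->
  left_cont 0 (j%:R / N%:R) (polyline N p).
Proof.
move=> N0; case: j => [|j].
  rewrite mul0r => eps eps0; exists 1 => // t; rewrite -eq_le => /eqP -> _.
  by rewrite subrr normr0 ltW.
have lt : j%:R / N%:R < j.+1%:R / N%:R :> R.
  by rewrite ltr_pM2r ?invr_gt0 ?ltr0n// ltr_nat.
exact: left_cont_widen lt (on_segment_left_cont lt (@polyline_on_segment N p j N0)).
Qed.

Lemma polyline_area N (p : nat -> V) : (0 < N)%N ->
  doubled_area 0 1 (polyline N p) (chain p 0 N).
Proof.
move=> N0; suff H j : doubled_area 0 (j%:R / N%:R) (polyline N p) (chain p 0 j).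
  by have := H N; rewrite divff// pnatr_eq0 -lt0n.
elim: j => [|j IH].
  rewrite mul0r /chain big_geq// => eps eps0; exists 1 => // m t tS.
  rewrite big_nat big1 ?subrr ?normr0// => k /andP[_ km].
  have := subdivision_mem tS km; have := subdivision_mem tS (ltnW km).
  by rewrite -!eq_le => /eqP <- /eqP <-; rewrite omegavv.
have lt : j%:R / N%:R < j.+1%:R / N%:R :> R.
  by rewrite ltr_pM2r ?invr_gt0 ?ltr0n// ltr_nat.
have seg := @polyline_on_segment N p j N0.
rewrite /chain big_nat_recr//=.
have x0 : 0 <= j%:R / N%:R :> R by exact: divr_ge0.
have ends := introT andP (conj x0 (ltW lt)).
exact: doubled_area_cat ends (polyline_left_cont p j N0) (on_segment_bounded lt seg)
  IH (doubled_area_segment lt seg).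
Qed.

Lemma polyline0 N (p : nat -> V) : polyline N p 0 = p 0%N.
Proof. by rewrite /polyline mulr0 truncn0 subrr segment0. Qed.

Lemma polyline1 N (p : nat -> V) : polyline N p 1 = p N.
Proof. by rewrite /polyline mulr1 natrK subrr segment0. Qed.

(** The closing segment from [g 1] to [g 0] contributes the area of the triangle with
the origin. *)
Lemma close_up_area g B : doubled_area 0 1 g B -> left_cont 0 1 g ->
  has_symplectic_area 0 2 (close_up g) ((B + omega (g 1) (g 0)) / 2).
Proof.
move=> area lc; apply: doubled_area_has_symplectic_area.
have eqg (t : R) : 0 <= t <= 1 -> g t = close_up g t by rewrite /close_up => /andP[_ ->].
have lt12 : 1 < 2 :> R by lra.
have seg : on_segment 1 2 (close_up g) (g 1) (g 0).
  move=> t /andP[t1 _]; have -> : 2 - 1 = 1 :> R by lra.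
  rewrite divr1 /close_up; case: leP => // t1'.
  have -> : t = 1 by lra.
  by rewrite subrr segment0.
have ends := introT andP (conj (@ler01 R) (ltW lt12)).
have lc' : left_cont 0 1 (close_up g).
  move=> eps /lc[eta eta0 H]; exists eta => // t t01 te.
  by rewrite -(eqg t)// -(eqg 1); [exact: H|rewrite ler01 lexx].
exact: doubled_area_cat ends lc' (on_segment_bounded lt12 seg)
  (eq_doubled_area eqg area) (doubled_area_segment lt12 seg).
Qed.
End Areas.

(** * Families of points near a Hoelder curve *)

Lemma powR_halfroot (R : realType) (i : nat) : 2 `^ (- (i%:R / 2)) = halfroot ^+ i :> R.
Proof.
by rewrite mulrC powRN powRrM powR12_sqrt// powR_mulrn ?sqrtr_ge0// /halfroot sqrtrV// exprVn.
Qed.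

Lemma sqrt_pow2V (R : realType) (i : nat) : Num.sqrt (2 ^- i) = halfroot ^+ i :> R.
Proof.
rewrite -exprVn -sqr_halfroot -exprM mulnC exprM sqrtr_sqr ger0_norm//.
by rewrite exprn_ge0// halfroot_ge0.
Qed.

Section Clamp.
Context {R : realType} {n : nat}.
Local Notation V := 'rV[R]_(n * 2).
Local Notation M := (omega_bound R n).
Variables (K : R) (gamma : R -> V) (Lambda : nat -> nat -> V).
Hypothesis K0 : 0 < K.
Hypothesis holder : forall s t : R, 0 <= s <= 1 -> 0 <= t <= 1 ->
  enorm (gamma s - gamma t) <= K * Num.sqrt `|s - t|.
Hypothesis near : forall i j : nat, (j <= 2 ^ i)%N ->
  enorm (Lambda i j - gamma (j%:R / 2 ^+ i)) <= K * 2 `^ (- (i%:R / 2)).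

(** Each level is continued by its last point, so that the estimates of the previous
sections hold for all indices. *)
Definition clamp (P : nat -> nat -> V) i j := P i (minn j (2 ^ i)).

Let pow2 i : 0 < 2 ^+ i :> R. Proof. by rewrite exprn_gt0. Qed.

Let pow2V i : 0 <= 2 ^- i :> R. Proof. by rewrite invr_ge0 ltW. Qed.

Let time_mem i j : (j <= 2 ^ i)%N -> 0 <= (j%:R / 2 ^+ i : R) <= 1.
Proof.
move=> ji; apply/andP; split; first by rewrite divr_ge0// ltW.
by rewrite ler_pdivrMr// mul1r -natrX ler_nat.
Qed.

Lemma near_curve i j i' (t : R) : (j <= 2 ^ i)%N -> (i' <= i)%N -> 0 <= t <= 1 ->
  `|j%:R / 2 ^+ i - t| <= 2 ^- i' -> `|Lambda i j - gamma t| <= 2 * K * halfroot ^+ i'.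
Proof.
move=> ji ii' t01 tj; rewrite -(subrKA (gamma (j%:R / 2 ^+ i))).
apply: (le_trans (ler_normD _ _)).
have -> : 2 * K * halfroot ^+ i' = K * halfroot ^+ i' + K * halfroot ^+ i' by ring.
apply: lerD.
  apply: (le_trans (ler_norm_enorm _)); apply: (le_trans (near ji)).
  rewrite powR_halfroot ler_pM2l//; apply: ler_wiXn2l => //.
    exact: halfroot_ge0.
  by have := @halfroot_le R; lra.
apply: (le_trans (ler_norm_enorm _)); apply: (le_trans (holder (time_mem ji) t01)).
by rewrite ler_pM2l// -sqrt_pow2V ler_wsqrtr.
Qed.

(** All five points belong to times within [2 ^- i] of each other. *)
Lemma width_clamp i j : width (cell (clamp Lambda) i j) <= 4 * K * halfroot ^+ i.
Proof.
have r0 : 0 <= halfroot ^+ i :> R by rewrite exprn_ge0// halfroot_ge0.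
apply: width_le; first by rewrite !mulr_ge0// ltW.
set c := minn j (2 ^ i).
have ci : (c <= 2 ^ i)%N by rewrite geq_minr.
have H u : u \in cell (clamp Lambda) i j -> `|u - gamma (c%:R / 2 ^+ i)| <= 2 * K * halfroot ^+ i.
  have base c' : (c <= c' <= c.+1)%N -> (c' <= 2 ^ i)%N ->
      `|Lambda i c' - gamma (c%:R / 2 ^+ i)| <= 2 * K * halfroot ^+ i.
    move=> /andP[cc' c'c] c'i; apply: near_curve => //; first exact: time_mem.
    rewrite -mulrBl -natrB// normrM ger0_norm// ger0_norm ?pow2V//.
    by rewrite ler_piMl ?pow2V// -[1]/(1%:R) ler_nat leq_subLR addn1.
  have next c' : (2 * c <= c' <= 2 * c + 2)%N -> (c' <= 2 ^ i.+1)%N ->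
      `|Lambda i.+1 c' - gamma (c%:R / 2 ^+ i)| <= 2 * K * halfroot ^+ i.
    move=> /andP[cc' c'c] c'i; apply: near_curve => //; first exact: time_mem.
    have -> : c%:R / 2 ^+ i = (2 * c)%:R / 2 ^+ i.+1 :> R.
      by rewrite exprS natrM -mulf_div divff// mul1r.
    rewrite -mulrBl -natrB// normrM ger0_norm// ger0_norm ?pow2V//.
    rewrite exprS invfM mulrA ler_piMl ?pow2V// ler_pdivrMr// mul1r.
    by rewrite ler_nat leq_subLR.
  rewrite !inE /clamp => /or4P[| | |/orP[]] /eqP ->; [apply: base|apply: base|
    apply: next|apply: next|apply: next]; rewrite ?geq_minr// /c ?expnS; lia.
move=> u v /H Hu /H Hv; rewrite -(subrKA (gamma (c%:R / 2 ^+ i))).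
apply: (le_trans (ler_normD _ _)); rewrite [`|_ - v|]distrC.
by apply: (le_trans (lerD Hu Hv)); lra.
Qed.

(** Beyond the last index the clamped family repeats its end point, so that its
cells there are parts of the last cell of [Lambda]. *)
Lemma width_clamp_diam i j :
  width (cell (clamp Lambda) i j) <= diam (cell Lambda i (minn j (2 ^ i).-1)).
Proof.
have e0 : (0 < 2 ^ i)%N by rewrite expn_gt0.
apply: width_le_diam => u; rewrite /cell /clamp expnS !inE.
have [ji|ij] := ltnP j (2 ^ i).
  have -> : minn j (2 ^ i).-1 = j by lia.
  rewrite !(minn_idPl _); [|lia..]; by [].
have -> : minn j (2 ^ i).-1 = (2 ^ i).-1 by lia.
rewrite !(minn_idPr _); [|lia..].
have -> : (2 * (2 ^ i).-1 + 2 = 2 * 2 ^ i)%N by lia.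
by rewrite prednK//; do 4?[case/orP]; move=> ->; rewrite ?orbT.
Qed.

Lemma band_clamp i : band (clamp Lambda) i 0 (2 ^ i) <=
  3 * \sum_(0 <= j < 2 ^ i) diam (cell Lambda i j) ^+ 2.
Proof.
have le2 j : width (cell (clamp Lambda) i j) ^+ 2
    <= diam (cell Lambda i (minn j (2 ^ i).-1)) ^+ 2.
  rewrite lerXn2r ?nnegrE ?width_ge0 ?width_clamp_diam//.
  by rewrite (le_trans _ (width_clamp_diam i j))// width_ge0.
rewrite /band big_split/=.
have e0 : (0 < 2 ^ i)%N by rewrite expn_gt0.
have : \sum_(0 <= j < 2 ^ i) width (cell (clamp Lambda) i j) ^+ 2
   <= \sum_(0 <= j < 2 ^ i) diam (cell Lambda i j) ^+ 2.
  rewrite big_nat [leRHS]big_nat; apply: ler_sum => j /andP[_ ji].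
  by apply: (le_trans (le2 j)); rewrite (minn_idPl _)//; lia.
suff : \sum_(0 <= j < 2 ^ i) width (cell (clamp Lambda) i j.+1) ^+ 2
   <= 2 * \sum_(0 <= j < 2 ^ i) diam (cell Lambda i j) ^+ 2 by lra.
move: le2; rewrite -(prednK e0)/=; set N := (2 ^ i).-1 => le2.
rewrite big_nat_recr//= [in leRHS]mulrDl mul1r; apply: lerD; last first.
  apply: (le_trans (le2 _)); rewrite (minn_idPr _)// big_nat_recr//= lerDr.
  by apply: sumr_ge0 => j _; exact: sqr_ge0.
rewrite big_nat_recl//= (@le_trans _ _ (\sum_(0 <= j < N) diam (cell Lambda i j.+1) ^+ 2))//.
  rewrite big_nat [leRHS]big_nat; apply: ler_sum => j /andP[_ jN].
  by apply: (le_trans (le2 _)); rewrite (minn_idPl _).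
by rewrite lerDr sqr_ge0.
Qed.

Lemma cvg_halfroot (a : R) : (fun m => a * halfroot ^+ m) @ \oo --> 0.
Proof.
apply: cvg_geometric; rewrite ger0_norm ?halfroot_ge0//.
by have := @halfroot_le R; lra.
Qed.

Lemma clamp_cvg (t : R) : 0 <= t <= 1 ->
  (fun m => clamp Lambda m (dyadic m t)) @ \oo --> gamma t.
Proof.
move=> t01; apply/cvgrPdist_le => e e0.
have H := cvgr0_norm_le _ (cvg_halfroot (2 * K)) _ e0.
near=> m; rewrite distrC; apply: (@le_trans _ _ `|2 * K * halfroot ^+ m|); last first.
  by near: m; exact: H.
have /andP[t0 t1] := t01.
have dm : (dyadic m t <= 2 ^ m)%N by rewrite -(@dyadic1 R m) dyadic_le.
rewrite /clamp (minn_idPl dm) ger0_norm; last first.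
  by rewrite !mulr_ge0 ?exprn_ge0 ?halfroot_ge0// ltW.
apply: near_curve => //; have /andP[lo hi] := dyadic_itv m t0.
have -> : (dyadic m t)%:R / 2 ^+ m - t = ((dyadic m t)%:R - 2 ^+ m * t) * 2 ^- m.
  by field; rewrite gt_eqF.
rewrite normrM [`|2 ^- m|]ger0_norm ?pow2V//.
rewrite ler_piMl ?pow2V// ler_norml; move: hi; rewrite -natr1; lra.
Unshelve. all: by end_near.
Qed.

Lemma holder_left_cont : left_cont 0 1 gamma.
Proof.
move=> e e0; have [m H] : exists m, K * halfroot ^+ m <= e.
  have [m _ H] := cvgr0_norm_le _ (cvg_halfroot K) _ e0.
  exists m; have := H m (leqnn m); rewrite ger0_norm//.
  by rewrite mulr_ge0 ?exprn_ge0 ?halfroot_ge0// ltW.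
exists (2 ^- m); first by rewrite invr_gt0.
move=> t t01 tm; apply: le_trans H; apply: (le_trans (ler_norm_enorm _)).
apply: (le_trans (holder t01 _)); first by rewrite ler01 lexx.
rewrite ler_pM2l// -sqrt_pow2V ler_wsqrtr// distrC ger0_norm; first exact: ltW.
by case/andP: t01; rewrite subr_ge0.
Qed.
End Clamp.

(** * The limit of the areas of the polygons *)

Section Limit.
Context {R : realType} {n : nat}.
Local Notation V := 'rV[R]_(n * 2).
Local Notation M := (omega_bound R n).
Variables (L : nat -> nat -> V) (K : R) (gamma : R -> V) (T : nat -> R).
Hypothesis K0 : 0 <= K.
Hypothesis dK : forall i j, width (cell L i j) <= K * halfroot ^+ i.
Hypothesis bandT : forall i m, (i <= m)%N -> \sum_(i <= l < m) band L l 0 (2 ^ l) <= T i.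
Hypothesis T_cvg0 : T @ \oo --> 0.
Hypothesis L_cvg : forall t : R, 0 <= t <= 1 ->
  (fun m => L m (dyadic m t)) @ \oo --> gamma t.

(** Twice the area of the closed polygon of level [m]. *)
Definition whole_excess m := excess (L m) 0 (2 ^ m).

Let half0 (i : nat) : 0./2 = 0%N. Proof. by []. Qed.
Let half1 i : (2 ^ i.+1)./2 = (2 ^ i)%N.
Proof. by rewrite expnS mul2n doubleK. Qed.
Let lt01 i : (0 <= i)%N -> (0 < 2 ^ i)%N. Proof. by rewrite expn_gt0. Qed.

Lemma whole_excess_le m N : (0 < m)%N ->
  `|whole_excess m| <= M * ((9 + 8 * N%:R) * T 0%N + 256 * K ^+ 2 * 2 ^- N).
Proof.
move=> m0; have := excess_bound half0 half1 lt01 K0 dK N m0 isT.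
move=> /le_trans; apply; rewrite ler_wpM2l ?omega_bound_ge0// add0n exprVn lerD2r.
by rewrite ler_wpM2l ?bandT// addr_ge0// mulr_ge0.
Qed.

Lemma whole_excess_noquad m :
  (forall i, quad (L i 0%N) (L i (2 ^ i)%N) (L i.+1 (2 ^ i.+1)%N) (L i.+1 0%N) = 0) ->
  `|whole_excess m| <= M * (4 * T 0%N).
Proof.
move=> q0; have := excess_sub_noquad half0 half1 lt01 (leq0n m) q0.
rewrite [excess (L 0%N) _ _](_ : _ = 0) ?subr0; last first.
  by rewrite /excess /chain big_nat1 subrr.
move=> /le_trans; apply; rewrite ler_wpM2l ?omega_bound_ge0// ler_wpM2l//.
exact: bandT.
Qed.

(** The area changes by summable amounts from level to level: the bound on the total
variation is finite already for [N = 0]. *)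
Lemma whole_excess_cvg : cvgn whole_excess.
Proof.
pose u m := whole_excess m.+1 - whole_excess m.
have H m : \sum_(0 <= i < m) `|u i| <= M * (8 * T 0%N + 256 * K ^+ 2).
  apply: (@le_trans _ _ (\sum_(0 <= i < m.+1) `|u i|)).
    by rewrite big_nat_recr//= lerDl.
  have B : band L 0 0 (2 ^ 0) <= \sum_(0 <= i < m.+1) band L i 0 (2 ^ i).
    by rewrite big_ltn// lerDl sumr_ge0// => i _; exact: band_ge0.
  have w : `|L 0%N (2 ^ 0)%N - L 0%N 0%N| <= width (cell L 0 0).
    by apply: le_width; rewrite !inE eqxx ?orbT.
  have w2 : width (cell L 0 0) ^+ 2 <= 2 * \sum_(0 <= i < m.+1) band L i 0 (2 ^ i).
    apply: (le_trans _ (ler_wpM2l _ B)) => //; rewrite /band big_nat1.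
    have := sqr_ge0 (width (cell L 0 0)); have := sqr_ge0 (width (cell L 0 1)); lra.
  have := variation_bound half0 half1 lt01 K0 dK 0 (leq0n m.+1) w w2.
  move=> /le_trans; apply; rewrite ler_wpM2l ?omega_bound_ge0//.
  rewrite mulr0 addr0 addn0 expr0 mulr1 lerD2r ler_wpM2l//; exact: bandT.
have cu : cvgn (series u).
  apply: normed_cvg; apply: nondecreasing_is_cvgn.
    apply/nondecreasing_seqP => m; rewrite [leRHS]seriesSr lerDl.
    exact: normr_ge0.
  by exists (M * (8 * T 0%N + 256 * K ^+ 2)) => _ [m _ <-]; exact: H.
rewrite (_ : whole_excess = fun m => series u m + whole_excess 0).
  by apply: is_cvgD => //; exact: is_cvg_cst.
by apply/funext => m; rewrite /series/= telescope_sumr// subrK.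
Qed.

(** For a fixed subdivision the excesses of its intervals at level [m] add up to the
difference between the chain of level [m] and the area sum at the points of level
[m]; as [m] grows, this tends to the difference to be estimated. The bound on it
is small because [N] is chosen first, for the geometric term, and then the mesh,
for the tail of the series, which is multiplied by [N]. *)
Lemma doubled_area_limit :
  doubled_area 0 1 gamma (limn whole_excess + omega (gamma 0) (gamma 1)).
Proof.
move=> eps eps0.
have [N HN] : exists N, M * (256 * K ^+ 2 * 2 ^- N) < eps / 2.
  pose X := M * (256 * K ^+ 2).
  have X0 : 0 <= X.
    exact: mulr_ge0 (omega_bound_ge0) (mulr_ge0 (ler0n R 256) (sqr_ge0 K)).
  have [|N HN] := @pow2V_lt R (eps / 2 / (X + 1)); first by rewrite !divr_gt0// ltr_wpDl.
  exists N; rewrite mulrA -/X; apply: (@le_lt_trans _ _ ((X + 1) * 2 ^- N)).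
    by rewrite ler_wpM2r ?lerDl// invr_ge0 exprn_ge0.
  by rewrite mulrC -ltr_pdivlMr// ltr_wpDl.
have [i1 Hi1] : exists i1, M * ((9 + 8 * N%:R) * T i1) <= eps / 4.
  pose X := M * (9 + 8 * N%:R).
  have X0 : 0 <= X by rewrite mulr_ge0 ?omega_bound_ge0.
  have X1 : 0 < X + 1 by rewrite ltr_wpDl.
  have e4 : 0 < eps / 4 / (X + 1) by rewrite !divr_gt0.
  have [i1 _ H] := cvgr0_norm_le _ T_cvg0 _ e4.
  exists i1; have := H i1 (leqnn i1); rewrite /= ler_pdivlMr// mulrA -/X => {}H.
  apply: le_trans H; apply: (@le_trans _ _ (X * `|T i1|)).
    by rewrite ler_wpM2l// ler_norm.
  by rewrite [leLHS]mulrC ler_wpM2l// lerDl.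
exists (2 ^- i1); first by rewrite invr_gt0 exprn_gt0.
move=> p t tS; have tmem := subdivision_mem tS; case: tS => t0 tp tS.
set S := \sum_(_ <= _ < _) _.
have [||m0 Hm0] := @partition_excess _ _ L K K0 dK t p i1 N _ _ tS; rewrite ?t0 ?tp//.
pose q (m : nat) (s : R) := L m (dyadic m s).
have lim : (fun m => whole_excess m + omega (q m 0) (q m 1)
    - \sum_(0 <= k < p) omega (q m (t k)) (q m (t k.+1))) @ \oo -->
    limn whole_excess + omega (gamma 0) (gamma 1) - S.
  apply: cvgB; first apply: cvgD.
  - exact: whole_excess_cvg.
  - by apply: cvg_omega; apply: L_cvg; rewrite ?ler01 ?lexx.
  - rewrite /S big_mkord.
    under eq_fun do rewrite big_mkord.
    apply: cvg_big => [|[k kp] _]; first exact: add_continuous.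
    by apply: cvg_omega; apply: L_cvg; apply: tmem => //; exact: ltnW.
apply: (@le_lt_trans _ _ (eps / 4 + M * (256 * K ^+ 2 * 2 ^- N))); last lra.
apply: (@ler_cvg_to _ _ _ _ _ (cst _) _ _ (cvg_norm lim) (cvg_cst _)).
exists (maxn i1 m0) => // m; rewrite /= geq_max => /andP[i1m m0m].
have [{}Hm0 _] := Hm0 m m0m; rewrite sum_excess in Hm0; last first.
  by move=> k /tS/andP[].
rewrite t0 tp dyadic0 dyadic1 in Hm0.
have -> : whole_excess m + omega (q m 0) (q m 1) = chain (L m) 0 (2 ^ m).
  by rewrite /whole_excess /excess /q dyadic0 dyadic1 subrK.
rewrite (le_trans Hm0)// subr0 mulr1 mulrDr lerD2r (le_trans _ Hi1)//.
rewrite ler_wpM2l ?omega_bound_ge0// ler_wpM2l ?addr_ge0 ?mulr_ge0//.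
under eq_bigr do rewrite dyadic0 dyadic1.
exact: bandT.
Qed.
End Limit.

(** * The logarithmic bound and the theorem *)

(** The number [N] of scales treated by Cauchy-Schwarz is free; it is chosen so
that [2 ^- N] is comparable to [sigma / lambda]. *)
Lemma le_mul_max_ln (R : realType) (a b c sigma lambda x : R) :
  0 <= a -> 0 <= b -> 0 <= c -> 0 <= sigma -> 0 < lambda ->
  (forall N : nat, x <= (a + b * N%:R) * sigma + c * lambda * 2 ^- N) ->
  x <= (a + b * (1 + (ln 2)^-1) + c) * (sigma * Num.max 1 (ln (lambda / sigma))).
Proof.
move=> a0 b0 c0 s0 l0 H; set X := Num.max _ _.
have X1 : 1 <= X by rewrite /X le_max lexx.
have ln2 : 0 < ln 2 :> R by rewrite ln_gt0// ltr1n.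
have ln2V : 0 < (ln 2)^-1 :> R by rewrite invr_gt0.
move: s0; rewrite le_eqVlt => /predU1P[s0|s0].
  rewrite -s0 mul0r mulr0 leNgt; apply/negP => x0.
  have cl : 0 < c * lambda + 1 by rewrite ltr_wpDl// mulr_ge0// ltW.
  have [|N HN] := @pow2V_lt R (x / (c * lambda + 1)); first by rewrite divr_gt0.
  have := H N; rewrite -s0 mulr0 add0r; move: HN; rewrite ltr_pdivlMr//.
  have : 0 < 2 ^- N :> R by rewrite invr_gt0 exprn_gt0.
  nra.
have [ls|sl] := leP (lambda / sigma) 1.
  have := H 0%N; rewrite expr0 invr1 mulr1 mulr0 addr0.
  rewrite ler_pdivrMr// mul1r in ls.
  have : sigma <= sigma * X by rewrite ler_peMr// ltW.
  have := mulr_ge0 b0 (ltW ln2V); nra.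
have [|N /andP[lo hi]] := @pow2V_level R (sigma / lambda).
  rewrite divr_gt0//= ler_pdivrMr// mul1r; move: sl; rewrite ltr_pdivlMr// mul1r.
  exact: ltW.
have N_le : N%:R <= (1 + (ln 2)^-1) * X.
  have : 2 ^+ N < 2 * (lambda / sigma).
    rewrite -ltf_pV2 ?posrE ?exprn_gt0 ?mulr_gt0 ?invr_gt0//.
    rewrite invfM invf_div; lra.
  move=> pN; have : ln (2 ^+ N) < ln (2 * (lambda / sigma)).
    by rewrite ltr_ln ?posrE ?exprn_gt0 ?mulr_gt0 ?invr_gt0.
  rewrite lnXn// lnM ?posrE ?divr_gt0// => lnN.
  have lX : ln (lambda / sigma) <= X by rewrite /X le_max lexx orbT.
  have : N%:R < 1 + (ln 2)^-1 * ln (lambda / sigma).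
    by rewrite -(ltr_pM2l ln2) mulrDr mulr1 mulrA divff ?gt_eqF// mul1r mulr_natr.
  have : (ln 2)^-1 * ln (lambda / sigma) <= (ln 2)^-1 * X by rewrite ler_pM2l.
  by rewrite mulrDl mul1r; move: (_ * X) (_ * ln _) => y z; lra.
apply: (le_trans (H N)).
have : c * lambda * 2 ^- N <= c * (sigma * X).
  rewrite -mulrA ler_wpM2l// (@le_trans _ _ sigma)//; last by rewrite ler_peMr// ltW.
  by rewrite mulrC -ler_pdivlMr.
have : b * N%:R * sigma <= b * (1 + (ln 2)^-1) * (sigma * X).
  have := ler_wpM2l (mulr_ge0 b0 (ltW s0)) N_le.
  by rewrite mulrAC => /le_trans; apply; apply: ler_eq; ring.
have : a * sigma <= a * (sigma * X) by rewrite ler_wpM2l// ler_peMr// ltW.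
lra.
Qed.

Theorem propositionB1 (R : realType) (n : nat) (hn : (1 <= n)%N) :
  exists2 c : R, 0 < c &
  forall (L : R) (gamma : R -> 'rV[R]_(n * 2)) (Lambda : nat -> nat -> 'rV[R]_(n * 2))
    (sigma : R),
  let h (i : nat) : R -> 'rV[R]_(n * 2) := polyline (2 ^ i) (Lambda i) in
  let delta (i j : nat) : R :=
    diam [:: Lambda i j; Lambda i j.+1; Lambda i.+1 (2 * j)%N;
             Lambda i.+1 (2 * j + 1)%N; Lambda i.+1 (2 * j + 2)%N] in
  0 < L ->
  (forall s t : R, 0 <= s <= 1 -> 0 <= t <= 1 ->
     enorm (gamma s - gamma t) <= L * Num.sqrt `|s - t|) ->
  (forall i j : nat, (j <= 2 ^ i)%N ->
     enorm (Lambda i j - gamma (j%:R / 2 ^+ i)) <= L * 2 `^ (- (i%:R / 2))) ->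
  series (fun i : nat => \sum_(0 <= j < 2 ^ i) delta i j ^+ 2) @ \oo --> sigma ->
  exists A : R,
    [/\ has_symplectic_area 0 2 (close_up gamma) A,
        exists2 B : nat -> R,
          (forall i : nat, has_symplectic_area 0 2 (close_up (h i)) (B i)) &
          B @ \oo --> A,
        `|A| <= c * (sigma * Num.max 1 (ln (L ^+ 2 / sigma))) &
        ((forall i : nat, h i 0 = h i 1) \/
         (forall i : nat, h i 0 = gamma 0 /\ h i 1 = gamma 1)) ->
        `|A| <= c * sigma].
Proof.
pose M := omega_bound R n.
have M0 : 0 < M by rewrite /M /omega_bound ltr0n muln_gt0 hn.
(* The numbers come from [whole_excess_le] with [T 0 = 3 * sigma] and
[K = 4 * L]: 27 = 9 * 3, 24 = 8 * 3, 4096 = 256 * 16. *)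
pose k : R := 27 + 24 * (1 + (ln 2)^-1) + 4096.
have ln2V : 0 <= (ln 2)^-1 :> R by rewrite invr_ge0 ln_ge0// ler1n.
have k0 : 0 < k by rewrite /k; lra.
exists (M / 2 * k); first by rewrite !mulr_gt0.
move=> L gamma Lambda sigma h delta L0 holder near cvg_sigma.
pose P := clamp Lambda; pose K := 4 * L.
pose s := series (fun i : nat => \sum_(0 <= j < 2 ^ i) delta i j ^+ 2).
pose T i := 3 * (sigma - s i).
have K0 : 0 <= K by rewrite mulr_ge0// ltW.
have dK := width_clamp L0 holder near.
have level_ge0 i : 0 <= \sum_(0 <= j < 2 ^ i) delta i j ^+ 2.
  by apply: sumr_ge0 => j _; exact: sqr_ge0.
have s_le m : s m <= sigma.
  rewrite -(cvg_lim _ cvg_sigma)//; apply: nondecreasing_cvgn_le.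
    by apply/nondecreasing_seqP => i; rewrite [leRHS]seriesSr lerDl.
  by apply/cvg_ex; exists sigma.
have T0E : T 0%N = 3 * sigma by rewrite /T /s /series/= big_geq// subr0.
have sigma0 : 0 <= sigma by have := s_le 0%N; rewrite /s /series/= big_geq.
have bandT i m : (i <= m)%N -> \sum_(i <= l < m) band P l 0 (2 ^ l) <= T i.
  move=> im; apply: (@le_trans _ _ (3 * (s m - s i))); last first.
    by rewrite ler_pM2l// lerD2r.
  rewrite /s sub_series_geq// mulr_sumr; apply: ler_sum => l _.
  exact: band_clamp.
have T_cvg0 : T @ \oo --> 0.
  rewrite -(mulr0 3) -(subrr sigma); apply: cvgM; first exact: cvg_cst.
  by apply: cvgB => //; exact: cvg_cst.
have P_cvg := clamp_cvg L0 holder near.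
have G_cvg := whole_excess_cvg K0 dK bandT.
set G := limn (whole_excess P) in G_cvg.
have GE i : whole_excess P i
    = chain (Lambda i) 0 (2 ^ i) + omega (Lambda i (2 ^ i)%N) (Lambda i 0%N).
  rewrite /whole_excess /excess (omegaC (Lambda i 0%N)) /P /clamp min0n minnn.
  congr (_ - _); apply: eq_big_nat => j /andP[_ ji].
  by rewrite !(minn_idPl _)// ltnW.
have G_norm C : (forall m, (0 < m)%N -> `|whole_excess P m| <= C) -> `|G / 2| <= C / 2.
  move=> H; rewrite normrM [`|2^-1|]ger0_norm// ler_pM2r//.
  apply: (@ler_cvg_to _ _ _ _ _ (cst C) _ _ (cvg_norm G_cvg) (cvg_cst _)).
  by exists 1%N => // m; exact: H.
exists (G / 2); split.
- have := close_up_area (doubled_area_limit K0 dK bandT T_cvg0 P_cvg)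
    (holder_left_cont L0 holder).
  by rewrite (omegaC (gamma 0)) addrK.
- exists (fun i => whole_excess P i / 2); last by apply: cvgM => //; exact: cvg_cst.
  move=> i; rewrite GE; have e0 : (0 < 2 ^ i)%N by rewrite expn_gt0.
  have := close_up_area (polyline_area (Lambda i) e0) _.
  rewrite polyline0 polyline1; apply.
  have := @polyline_left_cont R n (2 ^ i) (Lambda i) (2 ^ i) e0.
  by rewrite divff// pnatr_eq0 -lt0n.
- rewrite -mulrA; apply: (@le_trans _ _
      (M * (k * (sigma * Num.max 1 (ln (L ^+ 2 / sigma)))) / 2)); last first.
    by apply: ler_eq; field.
  apply: G_norm => m m0; rewrite -ler_pdivrMl//.
  apply: (@le_mul_max_ln _ 27 24 4096); rewrite ?ler0n ?exprn_gt0// => N.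
  rewrite ler_pdivrMl// (le_trans (whole_excess_le K0 dK bandT N m0))// ler_pM2l//.
  by rewrite T0E /K; apply: ler_eq; ring.
- move=> closed; apply: (@le_trans _ _ (M * (4 * T 0%N) / 2)).
    apply: G_norm => m _; apply: whole_excess_noquad => // i.
    have P0 l : P l 0%N = h l 0 by rewrite /h polyline0 /P /clamp min0n.
    have P1 l : P l (2 ^ l)%N = h l 1 by rewrite /h polyline1 /P /clamp minnn.
    rewrite !P0 !P1; case: closed => H.
      by rewrite -!H /quad !omegavv (omegaC (h i 0)); ring.
    have [-> ->] := H i; have [-> ->] := H i.+1.
    by rewrite /quad !omegavv (omegaC (gamma 0)); ring.
  rewrite T0E (_ : M * (4 * (3 * sigma)) / 2 = M / 2 * (12 * sigma)); last by field.
  rewrite -[leRHS]mulrA ler_pM2l ?divr_gt0// ler_wpM2r// /k; lra.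
Qed.
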